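(* There is a (Turing) computable function $\rho:\mathbb{N}\to\mathbb{N}$ such that for all indices $e$, all finite sequences $\vec F$ of total functionals $\mathbb{N}^{\mathbb{N}}\to\mathbb{N}$, all finite sequences $\vec f$ from $\mathbb{N}^{\mathbb{N}}$, all finite sequences $\vec a$ from $\mathbb{N}$ and all $b\in\mathbb{N}$: if $\{e\}_p(\mathcal{I},\vec F,\vec f,\vec a)=b$, then $\{\rho(e)\}_t(\mathcal{I},\vec F,\vec f,\vec a)=b$.
   Context: Non-monotone induction. Let $C=\{0,1\}^{\mathbb{N}}$, with the pointwise order, identified with the powerset of $\mathbb{N}$. For $F:C\to C$ define by transfinite recursion $f_0$ = constant $0$, $f_{\beta+1}=\max\{f_\beta,F(f_\beta)\}$, $f_\beta=\sup_{\gamma<\beta}f_\gamma$ for limit $\beta$. Let $\alpha_F$ be the least $\alpha$ with $f_\alpha=f_{\alpha+1}$, and put $\mathcal{I}(F)=f_{\alpha_F}$. Extension to partial $F:C\to C$ (each $F(f)$ is either an element of $C$ or totally undefined): $f_\beta$ is defined if $\beta=0$, or $\beta>0$ and both $f_\gamma$ and $F(f_\gamma)$ are defined for all $\gamma<\beta$; $\mathcal{I}(F)$ is defined if there is $\alpha$ such that $f_{\alpha+1}$ is defined and $f_\alpha=f_{\alpha+1}$, and then $\mathcal{I}(F)=f_\alpha$. For a (possibly partial) $G:\mathbb{N}^{\mathbb{N}}\to\mathbb{N}$ let $F_G(f)(n)=\min\{G(n^\frown f),1\}$ for $f\in C$, where $(n^\frown f)(0)=n$, $(n^\frown f)(k+1)=f(k)$;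 $F_G(f)$ is defined iff $G(n^\frown f)$ is defined for all $n$. Kleene computability. The relation $\{e\}(\mathcal{I},\vec F,\vec f,\vec a)=c$ is defined inductively (as the least relation) by the schemes, where $\vec F=(F_1,\dots,F_m)$, $\vec f=(f_1,\dots,f_n)$, $\vec a=(a_1,\dots,a_k)$: S1: $e=\langle1\rangle$, value $a_1+1$. S2: $e=\langle2,q\rangle$, value $q$. S3: $e=\langle3\rangle$, value $a_1$. S4: $e=\langle4,e_1,e_2\rangle$, value $\{e_1\}(\mathcal{I},\vec F,\vec f,b,\vec a)$ where $b=\{e_2\}(\mathcal{I},\vec F,\vec f,\vec a)$. S6: $e=\langle6,e_1,\tau_1,\tau_2,\tau_3\rangle$, value $\{e_1\}(\mathcal{I},\vec F_{\tau_1},\vec f_{\tau_2},\vec a_{\tau_3})$, the $\tau_i$ being permutations of the index sets of the input sequences. S7: $e=\langle7\rangle$, value $f_1(a_1)$. S8.2: $e=\langle8,2,d\rangle$, value $F_1(g)$ when $g(a)=\{d\}(\mathcal{I},\vec F,\vec f,a,\vec a)$ is a total function. S8.3: $e=\langle8,3,d\rangle$, $\{e\}(\mathcal{I},\vec F,\vec f,b,\vec a)=\mathcal{I}(F_G)(b)$ where $G(h)=\{d\}(\mathcal{I},\vec F,h,\vec f,\vec a)$. S9: $e=\langle9\rangle$, $\{e\}(\mathcal{I},\vec F,\vec f,d,\vec a)=\{d\}(\mathcal{I},\vec F,\vec f,\vec a)$. The relation $\{e\}_t$ is obtained when S8.3 is applied only if $G$ is total (Kleene's original requirement). The relation $\{e\}_p$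 is obtained when S8.3 is applied whenever $\mathcal{I}(F_G)$ is defined in the sense of the extension of $\mathcal{I}$ to partial functionals. *)

(* Defs.v *)
From mathcomp Require Import all_boot.
From Stdlib Require Cantor.

Set Implicit Arguments.
Unset Strict Implicit.
Unset Printing Implicit Defensive.

(* Partial functions are represented by their graphs throughout. *)

(* Ordinals are represented by the points of well-ordered types. *)

Definition well_order (W : Type) (lt : W -> W -> Prop) : Prop :=
  [/\ well_founded lt,
      forall u v w, lt u v -> lt v w -> lt u w
    & forall u v, [\/ lt u v, u = v | lt v u]].

Definition is_zero (W : Type) (lt : W -> W -> Prop) (v : W) : Prop :=
  forall w, ~ lt w v.

Definition is_next (W : Type) (lt : W -> W -> Prop) (w v : W) : Prop :=
  lt w v /\ forall u, ~ (lt w u /\ lt u v).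

Definition is_limit (W : Type) (lt : W -> W -> Prop) (v : W) : Prop :=
  ~ is_zero lt v /\ forall w, ~ is_next lt w v.

Definition Cantor_space : Type := nat -> bool.

(* [s] lists the stages f_w, for w in W, of the iteration of the partial
   operator F. All of them are defined: a point w of W lies below another one
   iff it has a successor in W, and then F (s w) is required to be defined. *)
Definition stages (F : Cantor_space -> Cantor_space -> Prop)
    (W : Type) (lt : W -> W -> Prop) (s : W -> Cantor_space) : Prop :=
  [/\ forall v, is_zero lt v -> forall n, s v n = false,
      forall w v, is_next lt w v ->
        exists2 g, F (s w) g & forall n, s v n = s w n || g n
    & forall v, is_limit lt v ->
        forall n, s v n <-> exists2 w, lt w v & s w n].

Definition nonmonotone_induction
    (F : Cantor_space -> Cantor_space -> Prop) (g : Cantor_space) : Prop :=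
  exists (W : Type) (lt : W -> W -> Prop) (s : W -> Cantor_space)
         (alpha alpha1 : W),
    [/\ well_order lt, stages F lt s, is_next lt alpha alpha1,
        s alpha =1 s alpha1 & g =1 s alpha].

Definition prepend (n : nat) (f : Cantor_space) : nat -> nat :=
  fun k => if k is k'.+1 then nat_of_bool (f k') else n.

Definition operator_of (G : (nat -> nat) -> nat -> Prop) :
    Cantor_space -> Cantor_space -> Prop :=
  fun f g => forall n,
    exists2 c, G (prepend n f) c & nat_of_bool (g n) = minn c 1.

(* The bijective coding <x_1, ..., x_k> of finite sequences. The choice matters:
   there is no scheme S5 of primitive recursion below, and definition by cases
   is available through S9 because <3> + 1 = <2, 0>, the successor of an index
   of a projection being an index of a constant function. *)
Fixpoint seq_code (s : seq nat) : nat :=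
  if s is x :: s' then (Cantor.to_nat (x, seq_code s')).+1 else 0.

(* Codes of nested sequences are huge unary numbers. *)
Arguments seq_code : simpl never.

(* An index does not fix the lengths of the inputs, so neither does the table
   [t] of a permutation occurring in it: indices beyond the end of the table
   are fixed points. Index sets start at 0. *)
Definition perm_at (t : seq nat) (i : nat) : nat := nth i t i.

Definition permutes (t : seq nat) (k : nat) : Prop :=
  perm_eq [seq perm_at t i | i <- iota 0 k] (iota 0 k).

Definition permuted (A : Type) (x0 : A) (t : seq nat) (s : seq A) : seq A :=
  [seq nth x0 s (perm_at t i) | i <- iota 0 (size s)].

(* [Kleene total_only e F f a c] is {e}(I, F, f, a) = c; the flag
   [total_only] restricts S8.3 to total G. *)
Inductive Kleene (total_only : bool) :
    nat -> seq ((nat -> nat) -> nat) -> seq (nat -> nat) -> seq nat -> nat ->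
    Prop :=
| S1 F f a1 a :
    Kleene total_only (seq_code [:: 1]) F f (a1 :: a) a1.+1
| S2 q F f a :
    Kleene total_only (seq_code [:: 2; q]) F f a q
| S3 F f a1 a :
    Kleene total_only (seq_code [:: 3]) F f (a1 :: a) a1
| S4 e1 e2 F f a b c :
    Kleene total_only e2 F f a b ->
    Kleene total_only e1 F f (b :: a) c ->
    Kleene total_only (seq_code [:: 4; e1; e2]) F f a c
| S6 e1 t1 t2 t3 F f a c :
    permutes t1 (size F) -> permutes t2 (size f) -> permutes t3 (size a) ->
    Kleene total_only e1 (permuted (fun=> 0) t1 F) (permuted (fun=> 0) t2 f)
      (permuted 0 t3 a) c ->
    Kleene total_only
      (seq_code [:: 6; e1; seq_code t1; seq_code t2; seq_code t3]) F f a c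
| S7 F f1 f a1 a :
    Kleene total_only (seq_code [:: 7]) F (f1 :: f) (a1 :: a) (f1 a1)
| S8_2 d F1 F f a (g : nat -> nat) :
    (forall x, Kleene total_only d (F1 :: F) f (x :: a) (g x)) ->
    Kleene total_only (seq_code [:: 8; 2; d]) (F1 :: F) f a (F1 g)
| S8_3 d F f b a (g : Cantor_space) :
    (total_only -> forall h, exists c, Kleene total_only d F (h :: f) a c) ->
    nonmonotone_induction
      (operator_of (fun h c => Kleene total_only d F (h :: f) a c)) g ->
    Kleene total_only (seq_code [:: 8; 3; d]) F f (b :: a) (nat_of_bool (g b))
| S9 d F f a c :
    Kleene total_only d F f a c ->
    Kleene total_only (seq_code [:: 9]) F f (d :: a) c.

Definition Kleene_t := Kleene true.
Definition Kleene_p := Kleene false.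

(* Computability of functions on the natural numbers is expressed by the
   partial recursive functions. *)

Inductive rec_prog : Type :=
| RZero | RSucc | RProj (i : nat)
| RComp (p : rec_prog) (qs : seq rec_prog)
| RPrec (p q : rec_prog)
| RMin (p : rec_prog).

Inductive rec_eval : rec_prog -> seq nat -> nat -> Prop :=
| eval_zero v : rec_eval RZero v 0
| eval_succ x v : rec_eval RSucc (x :: v) x.+1
| eval_proj i v : i < size v -> rec_eval (RProj i) v (nth 0 v i)
| eval_comp p qs v w y :
    size w = size qs ->
    (forall i, i < size qs -> rec_eval (nth RZero qs i) v (nth 0 w i)) ->
    rec_eval p w y -> rec_eval (RComp p qs) v y
| eval_prec0 p q v y :
    rec_eval p v y -> rec_eval (RPrec p q) (0 :: v) y
| eval_precS p q n v z y :
    rec_eval (RPrec p q) (n :: v) z -> rec_eval q (n :: z :: v) y ->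
    rec_eval (RPrec p q) (n.+1 :: v) y
| eval_min p v n :
    rec_eval p (n :: v) 0 ->
    (forall i, i < n -> exists y, rec_eval p (i :: v) y.+1) ->
    rec_eval (RMin p) v n.

Definition computable (rho : nat -> nat) : Prop :=
  exists p, forall x, rec_eval p [:: x] (rho x).

(* Main.v *)
Require Import Defs.
From mathcomp Require Import all_boot.
From mathcomp Require Import boolp.

Set Implicit Arguments.
Unset Strict Implicit.
Unset Printing Implicit Defensive.

(* A partial S8.3-induction is replaced by a total one that carries its own
   history. A stage X is coded by a set h of pairs <m, N> whose slice at 0 is X
   and whose slice at n + 1 is the stage at which n was about to enter X. On an
   arbitrary h, the new operator first decides by a total induction whether the
   membership relation "m + 1 below N iff <m, N> in h" is well-founded below 0,
   and then verifies h by recursion along it: a slice is accepted when it is the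
   union of the successors of accepted slices. Accepted slices are genuine
   stages, so the original functional is only ever called where it is defined,
   and the recursion converges. If h is accepted, the operator performs one step
   of the original induction; otherwise it adds nothing.

   The schemes cannot discard arbitrary arguments, so a translated index tolerates
   l extra functions and k extra numbers in front of the arguments of the source
   computation. *)

(** * Nonmonotone induction and uniqueness of Kleene computations *)

(** The obstacle is that S8.3 now demands a value at every set, while the source index need converge
    only along its own stages, and no scheme tests convergence. A bare set carries no evidence of
    being a stage. The slices supply it: genuine stages are closed under successors and arbitrary
    unions, so well-founded evidence built from these two operations certifies a stage before the
    source index is applied to it. The poverty of the schemes shapes the rest. A computed function
    can be passed to [F_1] but not to an index, so a slice must be recreated as a stage of an
    auxiliary induction before the source index can run on it. Branching is S9 applied to a computed
    index, search over all numbers is an induction, and a recursive program receives its own index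
    as an argument. The translator is such a program too; [rho] merely wraps [e] in an index that
    calls it at run time. *)

Lemma nonmonotone_induction_mono (F F' : Cantor_space -> Cantor_space -> Prop) g :
  (forall f g, F f g -> F' f g) ->
  nonmonotone_induction F g -> nonmonotone_induction F' g.
Proof.
move=> FF' [W [lt [s [v [v1 [wo [z nx lm] vv1 e1 e2]]]]]].
exists W, lt, s, v, v1; split=> //; split=> // w u /nx[g' Fg' e].
by exists g' => //; apply: FF'.
Qed.

(* The generated principle has no induction hypothesis for the computations
   inside [nonmonotone_induction]. *)
Lemma Kleene_nested_ind (b : bool)
  (P : nat -> seq ((nat -> nat) -> nat) -> seq (nat -> nat) -> seq nat -> nat -> Prop) :
  (forall F f a1 a, P (seq_code [:: 1]) F f (a1 :: a) a1.+1) ->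
  (forall q F f a, P (seq_code [:: 2; q]) F f a q) ->
  (forall F f a1 a, P (seq_code [:: 3]) F f (a1 :: a) a1) ->
  (forall e1 e2 F f a b c, P e2 F f a b -> P e1 F f (b :: a) c ->
     P (seq_code [:: 4; e1; e2]) F f a c) ->
  (forall e1 t1 t2 t3 F f a c,
     permutes t1 (size F) -> permutes t2 (size f) -> permutes t3 (size a) ->
     P e1 (permuted (fun=> 0) t1 F) (permuted (fun=> 0) t2 f)
       (permuted 0 t3 a) c ->
     P (seq_code [:: 6; e1; seq_code t1; seq_code t2; seq_code t3]) F f a c) ->
  (forall F f1 f a1 a, P (seq_code [:: 7]) F (f1 :: f) (a1 :: a) (f1 a1)) ->
  (forall d F1 F f a (g : nat -> nat),
     (forall x, P d (F1 :: F) f (x :: a) (g x)) ->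
     P (seq_code [:: 8; 2; d]) (F1 :: F) f a (F1 g)) ->
  (forall d F f x a (g : Cantor_space),
     nonmonotone_induction
       (operator_of (fun h c => Kleene b d F (h :: f) a c /\ P d F (h :: f) a c)) g ->
     P (seq_code [:: 8; 3; d]) F f (x :: a) (nat_of_bool (g x))) ->
  (forall d F f a c, P d F f a c -> P (seq_code [:: 9]) F f (d :: a) c) ->
  forall e F f a c, Kleene b e F f a c -> P e F f a c.
Proof.
move=> P1 P2 P3 P4 P6 P7 P82 P83 P9.
fix IH 6 => e F f a c H.
case: H.
- exact: P1.
- exact: P2.
- exact: P3.
- move=> e1 e2 F' f' a' b' c' H2 H1.
  by apply: P4; [exact: (IH _ _ _ _ _ H2) | exact: (IH _ _ _ _ _ H1)].
- move=> e1 t1 t2 t3 F' f' a' c' p1 p2 p3 H1.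
  by apply: P6 => //; exact: (IH _ _ _ _ _ H1).
- exact: P7.
- by move=> d F1 F' f' a' g H1; apply: P82 => x; exact: (IH _ _ _ _ _ (H1 x)).
- move=> d F' f' x a' g _ [W [lt [s [v [v1 [wo [z nx lm] vv1 e1 e2]]]]]].
  apply: P83; exists W, lt, s, v, v1; split=> //; split=> // w u wu.
  case: (nx w u wu) => g' Fg' eg; exists g' => // n.
  case: (Fg' n) => c' Kc' ec; exists c' => //; split=> //.
  exact: (IH _ _ _ _ _ Kc').
- by move=> d F' f' a' c' H1; apply: P9; exact: (IH _ _ _ _ _ H1).
Qed.

(** * Stages of an induction along a well-order, and comparison of two inductions *)

Definition union (P : Cantor_space -> Prop) : Cantor_space :=
  fun n => `[< exists2 f : Cantor_space, P f & f n >].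

Lemma unionP (P : Cantor_space -> Prop) n : reflect (exists2 f : Cantor_space, P f & f n) (union P n).
Proof. by rewrite /union; apply: asboolP. Qed.

Definition incl (f g : Cantor_space) := forall n, f n -> g n.

Lemma incl_refl f : incl f f. Proof. by []. Qed.

Lemma incl_trans g f h : incl f g -> incl g h -> incl f h.
Proof. by move=> fg gh n /fg /gh. Qed.

Lemma incl_anti f g : incl f g -> incl g f -> f = g.
Proof. by move=> fg gf; apply/funext => n; apply/idP/idP => [/fg|/gf]. Qed.

Section WellOrder.
Variables (W : Type) (lt : W -> W -> Prop).
Hypothesis wo : well_order lt.

Let lt_wf : well_founded lt. Proof. by case: wo. Qed.
Let lt_trans v u w : lt u v -> lt v w -> lt u w. Proof. by case: wo => _ tr _; apply: tr. Qed.
Let lt_total u v : [\/ lt u v, u = v | lt v u]. Proof. by case: wo. Qed.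

Let lt_irr v : ~ lt v v.
Proof. by elim/(well_founded_ind lt_wf): v => v IH vv; apply: (IH v). Qed.

Lemma wo_least (P : W -> Prop) v :
  P v -> exists2 u, P u & forall w, P w -> u = w \/ lt u w.
Proof.
elim/(well_founded_ind lt_wf): v => v IH Pv.
have [[w [wv Pw]]|no] := pselect (exists w, lt w v /\ P w); first exact: (IH w).
exists v => // w Pw; have [| |wv] := lt_total v w; [by right|by left|].
by case: no; exists w.
Qed.

Lemma wo_next v w : lt v w -> exists2 v', is_next lt v v' & v' = w \/ lt v' w.
Proof.
move=> vw; have [u vu min] := @wo_least (lt v) w vw; exists u; last exact: min.
split=> // x [vx xu]; case: (min x vx) => [e|ux]; first by subst; apply: lt_irr xu.
exact: lt_irr (lt_trans ux xu).
Qed.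

Lemma wo_cases v :
  [\/ is_zero lt v, exists w, is_next lt w v | is_limit lt v].
Proof.
have [z|nz] := pselect (is_zero lt v); first by constructor 1.
have [[w wv]|nn] := pselect (exists w, is_next lt w v); first by constructor 2; exists w.
by constructor 3; split=> // w wv; apply: nn; exists w.
Qed.

Lemma next_le v v' w : is_next lt v v' -> lt v w -> v' = w \/ lt v' w.
Proof.
move=> [vv' nb] vw; have [| |wv'] := lt_total v' w; [by right|by left|].
by case: (nb w).
Qed.

Lemma lt_next v v' w : is_next lt v v' -> lt w v' -> w = v \/ lt w v.
Proof.
move=> [vv' nb] wv'; have [| |vw] := lt_total w v; [by right|by left|].
by case: (nb w).
Qed.

Section Stages.
Variables (F : Cantor_space -> Cantor_space -> Prop) (s : W -> Cantor_space).
Hypothesis st : stages F lt s.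

Lemma stages_next w v : is_next lt w v ->
  exists2 g, F (s w) g & s v = (fun n => s w n || g n).
Proof. by case: st => _ + _ => /[apply] -[g Fg e]; exists g => //; apply/funext. Qed.

Lemma stages_mono w v : lt w v -> incl (s w) (s v).
Proof.
case: (st) => _ _ lm; elim/(well_founded_ind lt_wf): v w => v IH w wv.
have [z|[u uv]|l] := wo_cases v; first by case: (z w).
- have [g _ ->] := stages_next uv; case: (lt_next uv wv) => [->|wu] n sn; first by rewrite sn.
  by case: (uv) => /IH/(_ _ wu)/(_ _ sn) ->.
- by move=> n sn; apply/lm => //; exists w.
Qed.

Lemma stages_mono_le w v : w = v \/ lt w v -> incl (s w) (s v).
Proof. by case=> [->|/stages_mono]. Qed.

(** The least stage containing [n] is neither the empty stage nor a limit, since a limit stage only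
    collects earlier members. *)
Lemma stages_entry v n : s v n ->
  exists w w', [/\ is_next lt w w', ~~ s w n, s w' n & w' = v \/ lt w' v].
Proof.
move=> sv; have [u su min] := @wo_least (fun u => s u n) v sv.
case: (st) => zr _ lm.
have [z|[w wu]|l] := wo_cases u.
- by move: su; rewrite zr.
- exists w, u; split=> //; last exact: min.
  apply/negP => /min[e|uw]; case: wu => wu _; first by subst; apply: lt_irr wu.
  exact: lt_irr (lt_trans uw wu).
- case/lm: su => // w wu /min[e|uw]; first by subst; case: (lt_irr wu).
  by case: (lt_irr (lt_trans uw wu)).
Qed.

Variables top top1 : W.
Hypothesis top_next : is_next lt top top1.
Hypothesis top_fix : s top = s top1.

Definition stage (X : Cantor_space) := exists2 v, v = top \/ lt v top & X = s v.

Lemma stage_incl X : stage X -> incl X (s top).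
Proof. by case=> v vt ->; apply: stages_mono_le. Qed.

(** Below [top] the next index is still at most [top]; at [top] itself the fixed point gives the
    same set back. *)
Lemma stage_next X :
  stage X -> exists2 g, F X g & stage (fun n => X n || g n).
Proof.
case=> v [->|vt] ->.
  have [g Fg e] := stages_next top_next; exists g => //.
  by exists top; [left|rewrite -e].
have [v' vv' v't] := wo_next vt; have [g Fg e] := stages_next vv'.
by exists g => //; exists v'.
Qed.

(** Let [u] be the least bound of the indices of members of [P]. Either [s u] is itself a member, or
    all members lie strictly below [u]; then minimality excludes that [u] is a successor, and [s u]
    is empty or the union of earlier stages. *)
Lemma stage_union (P : Cantor_space -> Prop) :
  (forall X, P X -> stage X) -> stage (union P).
Proof.
move=> Pst.
pose ub u := forall v, (v = top \/ lt v top) -> P (s v) -> v = u \/ lt v u.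
have ubt : ub top by move=> v vt _.
have [u ubu min] := wo_least ubt.
exists u; first by case: (min top ubt); [left|right].
apply: incl_anti.
  move=> n /unionP[X PX Xn]; have [v vt e] := Pst X PX; subst X.
  by apply: stages_mono_le Xn; apply: ubu.
have [Pu|nPu] := pselect ((u = top \/ lt u top) /\ P (s u)).
  by move=> n sn; apply/unionP; exists (s u) => //; case: Pu.
have ult v : v = top \/ lt v top -> P (s v) -> lt v u.
  move=> vt Pv; case: (ubu v vt Pv) => // e; subst v.
  by case: nPu.
move=> n sn; apply/unionP.
case: (st) => zr _ lm.
have [z|[w wu]|l] := wo_cases u.
- by move: sn; rewrite zr.
- have ubw : ub w by move=> v vt Pv; apply: (lt_next wu); apply: ult.
  case: wu => wu _; case: (min w ubw) => [e|uw]; first by subst; case: (lt_irr wu).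
  by case: (lt_irr (lt_trans uw wu)).
- case/lm: sn => // w wu swn.
  have [[v [vt Pv wv]]|no] := pselect (exists v,
     [/\ v = top \/ lt v top, P (s v) & w = v \/ lt w v]).
    by exists (s v) => //; apply: stages_mono_le swn.
  have ubw : ub w.
    move=> v vt Pv; have [| |wv] := lt_total v w; [by right|by left|].
    by case: no; exists v; split=> //; right.
  case: (min w ubw) => [e|uw]; first by subst; case: (lt_irr wu).
  by case: (lt_irr (lt_trans uw wu)).
Qed.

End Stages.
End WellOrder.

(** The two well-orders need not be compared: the stages of the second induction up to its fixed
    point are closed under steps and unions, hence contain every stage of the first. *)
Lemma stages_stage F F' W (lt : W -> W -> Prop) s W' (lt' : W' -> W' -> Prop) s' top top1 :
  (forall f g g', F f g -> F' f g' -> g = g') ->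
  well_order lt -> stages F lt s ->
  well_order lt' -> stages F' lt' s' -> is_next lt' top top1 -> s' top = s' top1 ->
  forall v, stage lt' s' top (s v).
Proof.
move=> FF' wo st wo' st' tn tf v.
have lt_wf : well_founded lt by case: wo.
case: (st) => zr _ lm.
have su := stage_union wo' st' (top := top).
elim/(well_founded_ind lt_wf): v => v IH.
have [z|[w wv]|l] := wo_cases lt v.
- suff -> : s v = union (fun _ => False) by apply: su.
  by apply: incl_anti => n; [rewrite zr | case/unionP].
- have [g Fg ->] := stages_next st wv.
  case: (wv) => /IH sw _; have [g' Fg' sg'] := stage_next wo' st' tn tf sw.
  by rewrite (FF' _ _ _ Fg Fg').
- suff -> : s v = union (fun X => exists2 w, lt w v & X = s w).
    by apply: su => _ [w /IH + ->].
  apply: incl_anti => n; first by case/(lm _ l) => w wv sn; apply/unionP; exists (s w) => //; exists w.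
  by case/unionP => _ [w wv ->] sn; apply/(lm _ l); exists w.
Qed.

(** Each result is a stage of the other induction, hence included in its last stage. Two operators
    are allowed because, in the uniqueness of computations, only one of them carries the induction
    hypothesis. *)
Lemma nonmonotone_induction_unique F F' g g' :
  (forall f h h', F f h -> F' f h' -> h = h') ->
  nonmonotone_induction F g -> nonmonotone_induction F' g' -> g = g'.
Proof.
move=> FF' [W [lt [s [v [v1 [wo st vv1 e1 e2]]]]]].
move=> [W' [lt' [s' [v' [v1' [wo' st' vv1' e1' e2']]]]]].
rewrite (funext e2) (funext e2'); apply: incl_anti.
  apply: (stage_incl wo' st'); apply: (stages_stage FF' wo st wo' st' vv1').
  exact/funext.
apply: (stage_incl wo st); apply: (stages_stage _ wo' st' wo st vv1).
  by move=> f h h' Fh Fh'; apply/esym/(FF' _ _ _ Fh' Fh).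
exact/funext.
Qed.

(** * Uniqueness of the value of a computation *)

Lemma seq_code_inj : injective seq_code.
Proof.
elim=> [|x s IH] [|y t] //; rewrite /seq_code -/seq_code => /eq_add_S e.
have := f_equal Cantor.of_nat e; rewrite !Cantor.cancel_of_to.
by case=> -> /IH ->.
Qed.

Ltac code_inj := repeat match goal with
  | H : seq_code _ = seq_code _ |- _ => apply seq_code_inj in H
  | H : _ :: _ = _ :: _ |- _ => injection H as; subst
  end.

Ltac Kleene_inv H := match type of H with
  | Kleene _ ?e ?F ?f ?a ?c =>
    let e' := fresh "e'" in let F' := fresh "F'" in let f' := fresh "f'" in
    let a' := fresh "a'" in let E := fresh "E" in
    remember e as e' eqn:E; remember F as F' in H; remember f as f' in H;
    remember a as a' in H; destruct H; code_inj; try discriminate; subst; code_inj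
  end.

Lemma Kleene_unique b e F f a c c' :
  Kleene b e F f a c -> Kleene b e F f a c' -> c = c'.
Proof.
move=> H; move: c'.
elim/Kleene_nested_ind: H => {e F f a c}.
- by move=> F f a1 a c' H; Kleene_inv H.
- by move=> q F f a c' H; Kleene_inv H.
- by move=> F f a1 a c' H; Kleene_inv H.
- move=> e1 e2 F f a x c IH2 IH1 c' H; Kleene_inv H.
  apply: IH1; match goal with H : Kleene _ e2 _ _ _ _ |- _ => by rewrite (IH2 _ H) end.
- move=> e1 t1 t2 t3 F f a c _ _ _ IH c' H; Kleene_inv H.
  exact: IH.
- by move=> F f1 f a1 a c' H; Kleene_inv H.
- move=> d F1 F f a g IH c' H; Kleene_inv H.
  by congr F1; apply/funext => x; apply: IH.
- move=> d F f x a g nm c' H; Kleene_inv H.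
  congr (nat_of_bool (_ x)).
  match goal with H : nonmonotone_induction (operator_of (fun _ _ => Kleene _ _ _ _ _ _)) _ |- _ =>
    apply: nonmonotone_induction_unique nm H
  end.
  move=> h u u' hu hu'; apply/funext => n.
  have [z [_ IH] ez] := hu n; have [z' Kz' ez'] := hu' n.
  move: ez ez'; rewrite (IH _ Kz') => <-; by case: (u n) (u' n) => -[].
- move=> d F f a c IH c' H; Kleene_inv H; exact: IH.
Qed.
(** * Existence of the induction of a total functional *)

Section Tower.
Variable step : Cantor_space -> Cantor_space.
Hypothesis step_incl : forall f, incl f (step f).

(** Zermelo's device for avoiding ordinals: this family turns out to be well-ordered by inclusion,
    so it can itself index the stages. *)
Inductive tower : Cantor_space -> Prop :=
| tower_step f : tower f -> tower (step f)
| tower_union P : (forall f, P f -> tower f) -> tower (union P).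

Lemma union_sup (P : Cantor_space -> Prop) f : P f -> incl f (union P).
Proof. by move=> Pf n fn; apply/unionP; exists f. Qed.

Lemma union_least (P : Cantor_space -> Prop) g :
  (forall f, P f -> incl f g) -> incl (union P) g.
Proof. by move=> Pg n /unionP[f /Pg]; apply. Qed.

(** The extreme points of the Bourbaki-Witt argument: an extreme element is comparable with the
    whole tower, and this in turn makes every element of the tower extreme. *)
Let extreme x := forall y, tower y -> incl y x -> y <> x -> incl (step y) x.

Let extreme_dichotomy x y :
  extreme x -> tower y -> incl y x \/ incl (step x) y.
Proof.
move=> ex; elim=> {y} [y Ty [yx|xy]|P TP IH].
- have [->|ne] := pselect (y = x); first by right.
  by left; apply: ex.
- by right; apply: incl_trans (@step_incl y).
have [[p [Pp xp]]|no] := pselect (exists p, P p /\ incl (step x) p).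
  by right; apply: incl_trans xp (union_sup Pp).
left; apply: union_least => p Pp; have [//|xp] := IH p Pp.
by case: no; exists p.
Qed.

Let tower_extreme x : tower x -> extreme x.
Proof.
elim=> {x} [x Tx ex|P TP IH] y Ty yx ne.
  have [yx'|xy] := extreme_dichotomy ex Ty; last by case: ne; apply: incl_anti.
  have [->//|ne'] := pselect (y = x).
  by apply: incl_trans (@step_incl x); apply: ex.
have [[p [Pp py]]|no] := pselect (exists p, P p /\ ~ incl p y).
  have [yp|py'] := extreme_dichotomy (IH p Pp) Ty.
    have ne' : y <> p by move=> e; apply: py; rewrite e.
    exact: incl_trans (IH p Pp y Ty yp ne') (union_sup Pp).
  by case: py; apply: incl_trans py'.
case: ne; apply: incl_anti => //; apply: union_least => p Pp.
by apply: contrapT => py; apply: no; exists p.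
Qed.

Lemma tower_dichotomy x y : tower x -> tower y -> incl y x \/ incl (step x) y.
Proof. by move=> /tower_extreme; apply: extreme_dichotomy. Qed.

Let slt x y := incl x y /\ x <> y.

Let slt_step x y : tower x -> tower y -> slt x y -> incl (step x) y.
Proof.
move=> Tx Ty [xy ne]; have [yx|//] := tower_dichotomy Tx Ty.
by case: ne; apply: incl_anti.
Qed.

(** Quantifying over all [y] below [x] lets the induction follow the generation of [x]: anything
    strictly below a union is below one of its members. *)
Let tower_acc x : tower x ->
  forall y : {z | tower z}, incl (sval y) x ->
  Acc (fun u v : {z | tower z} => slt (sval u) (sval v)) y.
Proof.
elim=> {x} [x Tx IH|P TP IH] y yx.
  have [|xy] := tower_dichotomy Tx (proj2_sig y); first exact: IH.
  constructor=> z [zy ne].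
  have [|xz] := tower_dichotomy Tx (proj2_sig z); first exact: IH.
  case: ne; apply: incl_anti => //; exact: incl_trans yx xz.
constructor=> z [zy ne].
have [[p [Pp pz]]|no] := pselect (exists p, P p /\ ~ incl p (sval z)).
  apply: (IH p Pp); have [//|zp] := tower_dichotomy (TP p Pp) (proj2_sig z).
  by case: pz; apply: incl_trans zp.
case: ne; apply: incl_anti => //; apply: incl_trans yx _.
by apply: union_least => p Pp; apply: contrapT => pz; apply: no; exists p.
Qed.

(** The strict order by inclusion ends at the fixed point, but [nonmonotone_induction] asks for one
    more index there; [None] is that index and carries the same set. *)
Let Wt : Type := option {z | tower z}.
Let top : Cantor_space := union tower.
Let Ttop : tower top. Proof. exact: tower_union. Qed.
Let ltW (u v : Wt) : Prop :=
  match u, v with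
  | Some x, Some y => slt (sval x) (sval y)
  | Some _, None => True
  | _, _ => False
  end.
Let sW (u : Wt) := if u is Some x then sval x else top.

Let top_max x : tower x -> incl x top. Proof. exact: union_sup. Qed.

Let step_top : step top = top.
Proof.
by apply: incl_anti; [apply: top_max; constructor | apply: step_incl].
Qed.

Let fixed_max x : tower x -> step x = x -> x = top.
Proof.
move=> Tx fx; apply: incl_anti; first exact: top_max.
apply: union_least => y; elim=> {y} [y Ty yx|P TP IH]; last exact: union_least.
have [e|ne] := pselect (y = x); first by rewrite e fx.
exact: slt_step.
Qed.

Let ltW_wo : well_order ltW.
Proof.
have acc_some x : Acc ltW (Some x).
  elim: (tower_acc (proj2_sig x) (y := x) (@incl_refl _)) => {}x _ IH.
  by constructor=> -[y|//] /IH.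
split.
- by move=> [x|]; [exact: acc_some | constructor=> -[y _|] //; exact: acc_some].
- move=> [x|] [y|] [z|] //= [xy n1] [yz n2]; split; first exact: incl_trans yz.
  by move=> e; apply: n1; apply: incl_anti => //; rewrite e.
- move=> [x|] [y|]; [|by constructor 1|by constructor 3|by constructor 2].
  have [e|ne] := pselect (sval x = sval y).
    by constructor 2; case: x y e => [x Tx] [y Ty] /= e; subst y; rewrite (Prop_irrelevance Ty Tx).
  have [yx|xy] := tower_dichotomy (proj2_sig x) (proj2_sig y).
    by constructor 3; split=> // /esym.
  by constructor 1; split=> //; apply: incl_trans xy.
Qed.

Let pretop (y : {z | tower z}) : Cantor_space :=
  union (fun x => tower x /\ slt x (sval y)).

Lemma tower_stages (F : Cantor_space -> Cantor_space -> Prop) :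
  (forall f, exists2 g, F f g & step f = (fun n => f n || g n)) ->
  exists g, [/\ nonmonotone_induction F g, tower g & step g = g].
Proof.
move=> FS; exists top; split=> //.
exists Wt, ltW, sW, (Some (exist _ top Ttop)), None; split=> //.
  split.
  - move=> [x|] z n /=.
      apply/negP => xn; pose u : Cantor_space := union (fun _ => False).
      have Tu : tower u by apply: tower_union.
      apply: (z (Some (exist _ u Tu))); split=> /=.
        by apply: union_least.
      by move=> e; move: xn; rewrite -e => /unionP[].
    by case: (z (Some (exist _ top Ttop))).
  - move=> [x|] v wv; last by case: wv.
    have [g Fg e] := FS (sval x); exists g => // n /=.
    have -> : sW v = step (sval x); last by rewrite e.
    case: v wv => [y [/= xy nb]|[_ nb]] /=.
      have le := slt_step (proj2_sig x) (proj2_sig y) xy.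
      have [//|ne] := pselect (sval y = step (sval x)).
      have Tx : tower (step (sval x)) by constructor; apply: proj2_sig.
      case: (nb (Some (exist _ _ Tx))); split; split=> //=; last by move/esym.
      move=> fx; case: xy => xy; apply; apply: incl_anti => //.
      by rewrite (fixed_max (proj2_sig x) (esym fx)); apply: top_max (proj2_sig y).
    have -> : sval x = top; last by rewrite step_top.
    have [//|ne] := pselect (sval x = top).
    case: (nb (Some (exist _ top Ttop))); split=> //; split=> //=.
    exact: top_max (proj2_sig x).
  - move=> [y|] [nz nn] n /=; last first.
      by case: (nn (Some (exist _ top Ttop))); split=> // -[z|] [] //= [tz] nt _;
        apply: nt; apply: incl_anti => //; apply: top_max (proj2_sig z).
    split; last by case=> -[x|//] [xy _] /xy.
    have Tp : tower (pretop y) by apply: tower_union => x [].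
    have py : incl (pretop y) (sval y) by apply: union_least => x [_ []].
    (* If the tower elements strictly below [y] do not exhaust it, their union is an immediate
       predecessor of [y], which a limit cannot have. *)
    have [e|ne] := pselect (pretop y = sval y).
      rewrite -e => /unionP[x [Tx xy] xn].
      by exists (Some (exist _ x Tx)).
    case: (nn (Some (exist _ _ Tp))); split=> // -[z|] [] //= [pz nz'] zy.
    case: nz'; apply: incl_anti => //; apply: union_sup; split=> //.
    exact: proj2_sig.
split=> // -[z|] [] //= [tz] nt _.
by apply: nt; apply: incl_anti => //; apply: top_max (proj2_sig z).
Qed.

End Tower.

Definition op_step (phi : (nat -> nat) -> nat) (f : Cantor_space) : Cantor_space :=
  fun n => f n || (0 < phi (prepend n f)).

(** This interface hides the well-orders from the programs below: closure puts elements into [g],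
    and properties preserved by steps and unions bound [g] from above. *)
Lemma total_induction (phi : (nat -> nat) -> nat) :
  exists g : Cantor_space,
  [/\ nonmonotone_induction (operator_of (fun h c => c = phi h)) g,
      forall n, 0 < phi (prepend n g) -> g n
    & forall Q : Cantor_space -> Prop,
      (forall f, Q f -> Q (op_step phi f)) ->
      (forall P, (forall f, P f -> Q f) -> Q (union P)) -> Q g].
Proof.
have inc f : incl f (op_step phi f) by move=> n fn; rewrite /op_step fn.
have [|g [nm Tg e]] := @tower_stages (op_step phi) inc
   (operator_of (fun h c => c = phi h)).
  move=> f; exists (fun n => 0 < phi (prepend n f)) => // n.
  by exists (phi (prepend n f)) => //; case: (phi _).
exists g; split=> //.
  by move=> n pn; rewrite -e /op_step pn orbT.
by move=> Q Qs Qu; elim: {e nm}Tg => [f _|P _]; [exact: Qs|exact: Qu].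
Qed.
(** * Programming with Kleene indices *)

Notation K := (Kleene true).

(** S3 and S7 reach only the first argument. A transposition with 0 depends on the position alone,
    not on the number of inputs, which an index does not know. *)
Definition swapf k i := if i == 0 then k else if i == k then 0 else i.

Definition swap_tab k := mkseq (swapf k) k.+1.

Lemma perm_at_swap k i : perm_at (swap_tab k) i = swapf k i.
Proof.
rewrite /perm_at; case: (ltnP i k.+1) => ik; first by rewrite nth_mkseq.
rewrite nth_default ?size_mkseq // /swapf; case: eqP ik => [->|_] //.
by case: eqP => [->|//]; rewrite ltnn.
Qed.

Lemma swapfK k : involutive (swapf k).
Proof.
move=> i; rewrite /swapf; case: (i =P 0) => [->|i0]; first by rewrite eqxx; case: eqP.
by case: (i =P k) => [->|ik]; rewrite ?eqxx //; case: eqP => // _; case: eqP.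
Qed.

Lemma permutes_swap k n : k < n -> permutes (swap_tab k) n.
Proof.
move=> kn; apply: uniq_perm; rewrite ?iota_uniq //.
  rewrite (eq_map (perm_at_swap k)) map_inj_uniq ?iota_uniq //.
  exact: can_inj (@swapfK k).
have swap_lt i : i < n -> swapf k i < n.
  by rewrite /swapf; case: eqP => // _; case: eqP => // _ _; apply: leq_ltn_trans kn.
move=> i; rewrite (eq_map (perm_at_swap k)) mem_iota add0n /=.
apply/mapP/idP => [[j]|ltin]; first by rewrite mem_iota => /swap_lt ? ->.
by exists (swapf k i); rewrite ?swapfK // mem_iota add0n swap_lt.
Qed.

Lemma permutes_nil n : permutes [::] n.
Proof. by rewrite /permutes (eq_map (g := id)) ?map_id // => i; rewrite /perm_at nth_nil. Qed.

Lemma permuted_nil A (x0 : A) s : permuted x0 [::] s = s.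
Proof.
rewrite /permuted (eq_map (g := nth x0 s)) ?map_nth_iota0 ?take_size //.
by move=> i; rewrite /perm_at nth_nil.
Qed.

Lemma permuted_swap_head A (x0 : A) k s x s1 : drop k s = x :: s1 ->
  exists s', permuted x0 (swap_tab k) s = x :: s'.
Proof.
move=> e; have ks : k < size s by rewrite ltnNge -subn_eq0 -size_drop e.
have -> : x = nth x0 s k by rewrite -[k in nth _ _ k]addn0 -nth_drop e.
rewrite /permuted; case: s ks {e} => // y s ks.
by eexists; rewrite [iota _ _]/= [map _ _]/= perm_at_swap.
Qed.

(** The skipped block is not kept in order, only its length is. This is harmless, since the
    behaviour of a translated index depends on the number of extra arguments and not on their
    values. *)
Lemma permuted_swap_mid A (x0 : A) xs b a :
  exists2 xs', size xs' = size xs &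
  permuted x0 (swap_tab (size xs)) (b :: xs ++ a) = xs' ++ b :: a.
Proof.
case/lastP: xs => [|xs x].
  exists [::] => //; rewrite /permuted (eq_map (g := nth x0 (b :: a))).
    by rewrite map_nth_iota0 ?take_size.
  by move=> i; rewrite perm_at_swap /swapf; case: (i =P 0) => [->|].
exists (x :: xs); rewrite size_rcons // cat_rcons.
apply: (eq_from_nth (x0 := x0)); first by rewrite size_map size_iota /= !size_cat.
move=> i; rewrite size_map size_iota => ltis.
rewrite (nth_map 0) ?size_iota // nth_iota // add0n perm_at_swap /swapf.
case: i ltis => [_|i ltis] /=; first by rewrite nth_cat ltnn subnn.
rewrite eqSS; case: eqP => [->|ne] /=; first by rewrite nth_cat ltnn subnn.
rewrite !nth_cat; case: ltnP => // le.
by case: (i - _) (subn_eq0 i (size xs)) => [|//]; rewrite eqxx => /esym le'; case: ne; apply/eqP; rewrite eqn_leq le'.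
Qed.

Definition cst q := seq_code [:: 2; q].
(** S4 as a let binding: the value is pushed in front, so the [k] in [var k] is a de Bruijn
    index. *)
Definition lett e1 e2 := seq_code [:: 4; e2; e1].
Definition succ_ e := lett e (seq_code [:: 1]).
Definition numswap k e := seq_code [:: 6; e; 0; 0; seq_code (swap_tab k)].
Definition funswap k e := seq_code [:: 6; e; 0; seq_code (swap_tab k); 0].
Definition var k := numswap k (seq_code [:: 3]).
Definition appf k e := lett e (funswap k (seq_code [:: 7])).
Definition ind body e := lett e (seq_code [:: 8; 3; body]).
Definition call e := lett e (seq_code [:: 9]).

Lemma K_cst F f a q : K (cst q) F f a q.
Proof. exact: S2. Qed.

Lemma K_let F f a e1 e2 b c : K e1 F f a b -> K e2 F f (b :: a) c -> K (lett e1 e2) F f a c.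
Proof. exact: S4. Qed.

Lemma K_succ F f a e b : K e F f a b -> K (succ_ e) F f a b.+1.
Proof. by move=> H; apply: K_let H _; apply: S1. Qed.

Lemma K_numswap F f a k e c : k < size a ->
  K e F f (permuted 0 (swap_tab k) a) c -> K (numswap k e) F f a c.
Proof.
move=> ka H; apply: (S6 (t1 := [::]) (t2 := [::])); rewrite ?permuted_nil //;
  by [exact: permutes_nil | exact: permutes_swap].
Qed.

Lemma K_funswap F f a k e c : k < size f ->
  K e F (permuted (fun=> 0) (swap_tab k) f) a c -> K (funswap k e) F f a c.
Proof.
move=> ka H; apply: (S6 (t1 := [::]) (t3 := [::])); rewrite ?permuted_nil //;
  by [exact: permutes_nil | exact: permutes_swap].
Qed.

Lemma drop_lt A k (s : seq A) x s1 : drop k s = x :: s1 -> k < size s.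
Proof. by move=> e; rewrite ltnNge -subn_eq0 -size_drop e. Qed.

Lemma K_var F f a k x s : drop k a = x :: s -> K (var k) F f a x.
Proof.
move=> e; apply: K_numswap (drop_lt e) _.
by have [s' ->] := permuted_swap_head 0 e; apply: S3.
Qed.

Ltac kvar := eapply K_var; reflexivity.

Lemma K_appf F f a k e h s x : drop k f = h :: s -> K e F f a x -> K (appf k e) F f a (h x).
Proof.
move=> e1 H; apply: K_let H _; apply: K_funswap (drop_lt e1) _.
by have [s' ->] := permuted_swap_head (fun=> 0) e1; apply: S7.
Qed.

Lemma K_call F f a e i c : K e F f a i -> K i F f a c -> K (call e) F f a c.
Proof. by move=> He Hi; apply: K_let He _; apply: S9. Qed.

Lemma K_ind F f a body e (phi : (nat -> nat) -> nat) x :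
  (forall h, K body F (h :: f) a (phi h)) -> K e F f a x ->
  exists g : Cantor_space,
  [/\ K (ind body e) F f a (g x),
      forall n, 0 < phi (prepend n g) -> g n
    & forall Q : Cantor_space -> Prop,
      (forall f, Q f -> Q (op_step phi f)) ->
      (forall P, (forall f, P f -> Q f) -> Q (union P)) -> Q g].
Proof.
move=> Hb He; have [g [nm g1 g2]] := total_induction phi.
exists g; split=> //; apply: K_let He _; apply: S8_3 => [_ h|]; first by exists (phi h).
apply: nonmonotone_induction_mono nm => u v uv n.
by have [c -> eq_un] := uv n; exists (phi (prepend n u)).
Qed.

Opaque cst lett succ_ numswap funswap var appf ind call.

Definition addc c e := iter c succ_ e.

Lemma K_addc F f a c e x : K e F f a x -> K (addc c e) F f a (c + x).
Proof. by move=> H; elim: c => //= c IH; apply: K_succ. Qed.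

(** The operator has the constant value of [e], and the truncation of [F_G] at 1 does the work. *)
Definition sg_ e := lett e (ind (var 0) (cst 0)).

Lemma K_sg F f a e x : K e F f a x -> K (sg_ e) F f a (0 < x).
Proof.
move=> H; apply: K_let H _.
have [|g [Kg cl ad]] := @K_ind F f (x :: a) (var 0) (cst 0) (fun=> x) 0 _ (K_cst _ _ _ _).
  by move=> h; kvar.
have -> // : 0 < x = g 0.
apply/idP/idP; first exact: (cl 0).
apply: (ad (fun f => f 0 -> 0 < x)) => [u IH|P IH]; first by case/orP.
by case/unionP => u /IH.
Qed.

(* <3> = 7 and <2, 0> = 8: the code computed at run time returns the first
   argument y, or 0. *)
Definition ifz0 c y := lett (addc 7 (sg_ c)) (lett (cst y) (call (var 1))).

Lemma K_ifz0 F f a c y x : K c F f a x -> K (ifz0 c y) F f a (if x == 0 then y else 0).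
Proof.
move=> /K_sg/(K_addc 7) H; apply: K_let H _; apply: K_let (K_cst _ _ _ _) _.
apply: K_call; first kvar.
case: x => [|x].
  have -> : 7 + (0 < 0) = seq_code [:: 3] by [].
  exact: S3.
have -> : 7 + (0 < x.+1) = seq_code [:: 2; 0] by [].
exact: S2.
Qed.

(** The smaller index, plus either 0 or the difference, is computed first and called afterwards.
    Only the selected branch is run, so the other one may diverge. *)
Definition ifz c i0 i1 :=
  if i1 <= i0 then call (addc i1 (ifz0 c (i0 - i1)))
  else call (addc i0 (ifz0 (ifz0 c 1) (i1 - i0))).

Lemma K_ifz F f a c i0 i1 x y : K c F f a x ->
  (x = 0 -> K i0 F f a y) -> (0 < x -> K i1 F f a y) -> K (ifz c i0 i1) F f a y.
Proof.
move=> H H0 H1; rewrite /ifz; case: leqP => le.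
  apply: K_call (K_addc _ (K_ifz0 _ H)) _.
  by case: x H0 H1 {H} => [/(_ erefl) + _|x _ /(_ isT)]; rewrite ?subnKC ?addn0.
apply: K_call (K_addc _ (K_ifz0 _ (K_ifz0 _ H))) _.
by case: x H0 H1 {H} => [/(_ erefl) + _|x _ /(_ isT)] /=; rewrite ?addn0 // subnKC // ltnW.
Qed.

Opaque ifz0 sg_ ifz.

Ltac krun := repeat match goal with
  | |- Kleene true (cst _) _ _ _ _ => apply: K_cst
  | |- Kleene true (var _) _ _ _ _ => kvar
  | |- Kleene true (succ_ _) _ _ _ _ => apply: K_succ
  | |- Kleene true (addc _ _) _ _ _ _ => apply: K_addc
  | |- Kleene true (appf _ _) _ _ _ _ => eapply K_appf; [reflexivity|]
  end.

(* The operator propagates membership downwards from n + 1 to n, so that 0 enters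
   iff some n satisfies phi; the bound n is the first value of the new function. *)
Definition exq phi :=
  ind (ifz phi (appf 0 (succ_ (succ_ (appf 0 (cst 0))))) (cst 1)) (cst 0).

Lemma K_exq F f a phi (chi : nat -> nat) :
  (forall h, K phi F (h :: f) a (chi (h 0))) ->
  K (exq phi) F f a `[< exists n, 0 < chi n >].
Proof.
(* Position 0 holds the candidate n, so membership of n + 1 is read at position n + 2. *)
move=> H; pose p h := if chi (h 0) is 0 then h (h 0).+2 else 1.
have [||g [Kg cl ad]] := @K_ind F f a
  (ifz phi (appf 0 (succ_ (succ_ (appf 0 (cst 0))))) (cst 1)) (cst 0) p 0; [|by krun|].
  move=> h; apply: K_ifz (H h) _ _ => e.
    by rewrite /p e; krun.
  by rewrite /p; case: (chi _) e => // ? _; krun.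
suff <- : g 0 = `[< exists n, 0 < chi n >] by [].
have down n m : g (n + m) -> g m.
  elim: n => // n IH gn; apply: IH; apply: cl; rewrite /p /=.
  by case: (chi _) => //=; rewrite -addSn gn.
apply/idP/asboolP => [|[n en]]; last first.
  by apply: (down n); rewrite addn0; apply: cl; rewrite /p /=; case: (chi n) en.
apply: (ad (fun u => forall n, u n -> exists n, 0 < chi n)).
  move=> u IH n /orP[/IH //|]; rewrite /p /=.
  case e: (chi n) => [|c]; last by exists n; rewrite e.
  by case e': (u _) => // _; apply: IH e'.
by move=> P IH n /unionP[u /IH]; apply.
Qed.

(* The stages are {0, ..., i - 1} for i <= y + 1: nothing enters after y. *)
Definition leqi := ind (ifz (appf 0 (succ_ (var 1)))
  (ifz (appf 0 (cst 0)) (cst 1) (appf 0 (appf 0 (cst 0)))) (cst 0)) (var 0).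

Lemma K_leqi F f a x y : K leqi F f (x :: y :: a) (x <= y).
Proof.
pose p (h : nat -> nat) := if h y.+1 is 0 then if h 0 is 0 then 1 else h (h 0) else 0.
have [| |g [Kg cl ad]] := @K_ind F f (x :: y :: a) (ifz (appf 0 (succ_ (var 1)))
  (ifz (appf 0 (cst 0)) (cst 1) (appf 0 (appf 0 (cst 0)))) (cst 0)) (var 0) p x.
- move=> h; eapply K_ifz; [by krun| |] => e; last by rewrite /p; case: (h _) e => // *; krun.
  rewrite /p e; eapply K_ifz; [by krun| |] => e'; first by rewrite e'; krun.
  by case e2: (h 0) e' => [//|n] _; rewrite -e2; krun.
- by krun.
suff <- : g x = (x <= y) by [].
(* If [y] never entered, nothing would stop the growth, and every number, [y] included, would
   enter. *)
have gy : g y.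
  case e: (g y) => //; suff gn n : g n by rewrite gn in e.
  elim: n => [|n IH]; apply: cl; first by rewrite /p /= e.
  by rewrite /p /= e IH.
pose Q (u : Cantor_space) := (forall n, u n.+1 -> u n) /\ (forall n, u n -> n <= y).
have [dn le] : Q g.
  apply: (ad Q) => [u [dn le]|P IH].
    split=> n; rewrite /op_step /p /=.
      case/orP => [/dn ->//|]; case: (u y) => //=; by case: (u n).
    case/orP => [/le //|]; case e: (u y) => //=; case: n => [//|n].
    rewrite /=; case en: (u n) => // _; rewrite ltn_neqAle (le _ en) andbT.
    by apply: contraFneq e => <-; rewrite en.
  by split=> n /unionP[u Pu un]; [apply/unionP; exists u => //|]; apply (IH u Pu).
apply/idP/idP => [/le //|/subnK e].
move: gy; rewrite -e; elim: (y - x) => // n IH; by rewrite addSn => /dn.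
Qed.

(** Copies are pushed from the last to the first, so position [i] has moved by [size s'] when its
    turn comes. *)
Fixpoint copy (s : seq nat) j :=
  if s is i :: s' then copy s' (lett (var (i + size s')) j) else j.

Lemma K_copy F f a s j c : all (fun i => i < size a) s ->
  K j F f ([seq nth 0 a i | i <- s] ++ a) c -> K (copy s j) F f a c.
Proof.
elim: s j => //= i s IH j /andP[ia sa] H; apply: IH => //.
apply: K_let H; apply: (@K_var _ _ _ _ _ (drop (i.+1) a)).
by rewrite drop_cat size_map ltnNge leq_addl /= addnK (drop_nth 0).
Qed.

(** * Primitive recursive functions *)

(** This class is used twice: its members get Kleene indices, for work done inside computations, and
    recursive programs, for [rho]. *)
Inductive primrec : nat -> (seq nat -> nat) -> Prop :=
| pr_cst0 n : primrec n (fun=> 0)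
| pr_succ n phi : primrec n phi -> primrec n (fun v => (phi v).+1)
| pr_nth n i : i < n -> primrec n (fun v => nth 0 v i)
| pr_comp n m phi psi :
    primrec m phi -> (forall i, i < m -> primrec n (psi i)) ->
    primrec n (fun v => phi (mkseq (psi^~ v) m))
| pr_rec n base step k :
    primrec n base -> primrec n.+2 step -> primrec n k ->
    primrec n (fun v =>
      nat_rec (fun=> nat) (base v) (fun i acc => step (i :: acc :: v)) (k v))
| pr_ext n phi psi :
    primrec n phi -> (forall v, size v = n -> phi v = psi v) -> primrec n psi.

Definition K_computes n j phi := forall F f v rest,
  size v = n -> K j F f (v ++ rest) (phi v).

Lemma K_computes_comp n m psi :
  (forall i, i < m -> exists j, K_computes n j (psi i)) ->
  forall e, exists j, forall F f v rest y, size v = n ->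
  K e F f (mkseq (psi^~ v) m ++ v ++ rest) y -> K j F f (v ++ rest) y.
Proof.
elim: m psi => [|m IH] psi Hpsi e; first by exists e.
have [j0 H0] := Hpsi 0 isT.
have [i im|j Hj] := IH (fun i => psi i.+1) _ (lett (copy (iota m n) j0) e).
  exact: (Hpsi i.+1).
exists j => F f v rest y sv H; apply: (Hj) => //.
apply: (@K_let _ _ _ _ _ (psi 0 v)).
  have sw : size (mkseq (fun i => psi i.+1 v) m) = m by rewrite size_mkseq.
  apply: K_copy.
    apply/allP => i; rewrite mem_iota !size_cat sw sv => /andP[_ lt].
    by rewrite addnA (leq_trans lt) // leq_addr.
  have -> : [seq nth 0 (mkseq (fun i => psi i.+1 v) m ++ v ++ rest) i | i <- iota m n] = v.
    rewrite catA; apply: (eq_from_nth (x0 := 0)); first by rewrite size_map size_iota.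
    move=> i; rewrite size_map size_iota => lt.
    rewrite (nth_map 0) ?size_iota // nth_iota // nth_cat size_cat sw sv ltn_add2l lt.
    by rewrite nth_cat sw ltnNge leq_addr /= addKn.
  exact: H0.
move: H; rewrite /mkseq /= (iotaDl 1 0 m) -map_comp.
by congr (K e F f (_ :: _ ++ _) y); apply: eq_map.
Qed.

(* A loop on the arguments q, i, acc, m, v, where q is the index of the loop
   itself: it runs until m <= i. *)
Definition rec_body n step :=
  ifz (copy [:: 3; 1] leqi)
    (lett (copy [:: 1, 2 & iota 4 n] step)
      (lett (succ_ (var 2))
        (copy [:: 2, 0, 1, 5 & iota 6 n] (call (var 0)))))
    (var 2).

Lemma map_nth_window A (x0 : A) s v r :
  [seq nth x0 (s ++ v ++ r) i | i <- iota (size s) (size v)] = v.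
Proof.
apply: (eq_from_nth (x0 := x0)); first by rewrite size_map size_iota.
move=> i; rewrite size_map size_iota => lt.
by rewrite (nth_map 0) ?size_iota // nth_iota // nth_cat ltnNge leq_addr /= addKn nth_cat lt.
Qed.

Lemma all_window A (s v r : seq A) :
  all (fun i => i < size (s ++ v ++ r)) (iota (size s) (size v)).
Proof.
apply/allP => i; rewrite mem_iota !size_cat addnA => /andP[_ lt].
exact: leq_trans lt (leq_addr _ _).
Qed.

Lemma K_computes_rec n base step j :
  K_computes n.+2 j step ->
  forall F f v rest i m, size v = n ->
  let r k := nat_rec (fun=> nat) (base v) (fun i acc => step (i :: acc :: v)) k in
  let q := rec_body n j in
  i <= m -> K q F f (q :: i :: r i :: m :: v ++ rest) (r m).
Proof.
move=> Hj F f v rest i m sv r q; rewrite -sv in q *.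
(* [rest] is generalized because every round of the loop leaves its working arguments behind. *)
elim: {i}(m - i) {-2}i (erefl (m - i)) rest => [|d IH] i e rest im.
  have ei : i = m by apply/eqP; rewrite eqn_leq im -subn_eq0 e.
  rewrite {2}/q ei; apply: (@K_ifz _ _ _ _ _ _ 1) => [|//|_]; last by krun.
  apply: K_copy => //=; suff -> : 1 = (m <= m) :> nat by apply: K_leqi.
  by rewrite leqnn.
have {}im : i < m by rewrite -subn_gt0 e.
rewrite {2}/q; apply: (@K_ifz _ _ _ _ _ _ 0) => [|_|//].
  apply: K_copy => //=; suff -> : 0 = (m <= i) :> nat by apply: K_leqi.
  by rewrite leqNgt im.
apply: (@K_let _ _ _ _ _ (r i.+1)).
  apply: K_copy; first exact: (all_window [:: q; i; r i; m] v rest).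
  rewrite [map _ _]/= (map_nth_window 0 [:: q; i; r i; m] v rest).
  by apply: (Hj F f (i :: r i :: v)); rewrite /= sv.
apply: K_let; first by krun.
apply: K_copy; first exact: (all_window [:: i.+1; r i.+1; q; i; r i; m] v rest).
rewrite [map _ _]/= (map_nth_window 0 [:: i.+1; r i.+1; q; i; r i; m] v rest).
apply: K_call; first by krun.
apply: (IH i.+1 _ ([:: i.+1; r i.+1; q; i; r i; m] ++ v ++ rest)) => //.
by rewrite subnS e.
Qed.

Lemma primrec_K n phi : primrec n phi -> exists j, K_computes n j phi.
Proof.
elim=> {n phi} [n|n phi _ [j Hj]|n i lt|n m phi psi _ [j Hj] _ IH
  |n base step k _ [jb Hb] _ [js Hs] _ [jk Hk]|n phi psi _ [j Hj] e].
- by exists (cst 0) => F f v rest _; krun.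
- by exists (succ_ j) => F f v rest sv; krun; apply: Hj.
- exists (var i) => F f v rest sv.
  apply: (@K_var _ _ _ _ _ (drop i.+1 v ++ rest)).
  by rewrite drop_cat sv lt (drop_nth 0) ?sv.
- have [j' Hj'] := K_computes_comp IH j.
  by exists j' => F f v rest sv; apply: Hj' => //; apply: Hj; rewrite size_mkseq.
- exists (lett jk (lett (copy (iota 1 n) jb) (lett (cst 0)
    (lett (cst (rec_body n js)) (rec_body n js))))) => F f v rest sv.
  apply: K_let (Hk _ _ _ _ sv) _; apply: (@K_let _ _ _ _ _ (base v)).
    rewrite -sv; apply: K_copy; first exact: (all_window [:: k v] v rest).
    by rewrite (map_nth_window 0 [:: k v] v rest); apply: Hb.
  apply: K_let (K_cst _ _ _ _) _; apply: K_let (K_cst _ _ _ _) _.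
  exact: (K_computes_rec base Hs F f rest (i := 0)).
- by exists j => F f v rest sv; rewrite -e //; apply: Hj.
Qed.

Lemma primrec_rec n phi : primrec n phi ->
  exists p, forall v, size v = n -> rec_eval p v (phi v).
Proof.
elim=> {n phi} [n|n phi _ [p Hp]|n i lt|n m phi psi _ [p Hp] _ IH
  |n base step k _ [pb Hb] _ [ps Hs] _ [pk Hk]|n phi psi _ [p Hp] e].
- by exists RZero => v _; apply: eval_zero.
- exists (RComp RSucc [:: p]) => v sv.
  apply: (@eval_comp _ _ _ [:: phi v]) => //; last exact: eval_succ.
  by case=> //= _; apply: Hp.
- by exists (RProj i) => v sv; apply: eval_proj; rewrite sv.
- have [ps [sps Hps]] : exists ps, size ps = m /\ forall i, i < m ->
      forall v, size v = n -> rec_eval (nth RZero ps i) v (psi i v).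
    elim: m psi {phi Hp} IH => [|m IHm] psi IH; first by exists [::].
    have [p0 H0] := IH 0 isT.
    have [i im|ps [sps Hps]] := IHm (fun i => psi i.+1); first exact: (IH i.+1).
    by exists (p0 :: ps); split=> [|[|i]] //=; [rewrite sps | move=> im; apply: Hps].
  exists (RComp p ps) => v sv.
  apply: (@eval_comp _ _ _ (mkseq (psi^~ v) m)); rewrite ?size_mkseq ?sps //.
    by move=> i im; rewrite nth_mkseq //; apply: Hps.
  by apply: Hp; rewrite size_mkseq.
- exists (RComp (RPrec pb ps) (pk :: [seq RProj i | i <- iota 0 n])) => v sv.
  apply: (@eval_comp _ _ _ (k v :: v)); first by rewrite /= size_map size_iota sv.
    case=> [_|i]; first exact: Hk.
    rewrite /= size_map size_iota ltnS => lt.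
    rewrite (nth_map 0) ?size_iota // nth_iota //.
    by apply: eval_proj; rewrite sv.
  elim: (k v) => [|i IH] /=; first by apply: eval_prec0; apply: Hb.
  by apply: eval_precS IH _; apply: Hs; rewrite /= sv.
- by exists p => v sv; rewrite -e //; apply: Hp.
Qed.

(** * Primitive recursive arithmetic on codes of sequences *)

Lemma pr_cst n q : primrec n (fun=> q).
Proof. by elim: q => [|q IH]; [exact: pr_cst0 | exact: pr_succ]. Qed.

Lemma pr_comp1 phi n x : primrec 1 (fun v => phi (nth 0 v 0)) ->
  primrec n x -> primrec n (fun v => phi (x v)).
Proof. by move=> H Hx; apply: (pr_ext (pr_comp (psi := fun=> x) H _)). Qed.

Lemma pr_comp2 phi n x y : primrec 2 (fun v => phi (nth 0 v 0) (nth 0 v 1)) ->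
  primrec n x -> primrec n y -> primrec n (fun v => phi (x v) (y v)).
Proof.
move=> H Hx Hy.
by apply: (pr_ext (pr_comp (psi := nth x [:: x; y]) H _)) => // -[|[|]].
Qed.

Lemma pr_comp3 phi n x y z :
  primrec 3 (fun v => phi (nth 0 v 0) (nth 0 v 1) (nth 0 v 2)) ->
  primrec n x -> primrec n y -> primrec n z ->
  primrec n (fun v => phi (x v) (y v) (z v)).
Proof.
move=> H Hx Hy Hz.
by apply: (pr_ext (pr_comp (psi := nth x [:: x; y; z]) H _)) => // -[|[|[|]]].
Qed.

Lemma pr_comp_cons n m g x (k := m - n) : primrec n.+1 g -> primrec m x -> n <= m ->
  primrec m (fun u => g (x u :: drop k u)).
Proof.
move=> Hg Hx nm; pose psi i := if i is i'.+1 then fun u => nth 0 u (k + i') else x.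
apply: (pr_ext (pr_comp (psi := psi) Hg _)).
  by case=> // i lt; apply: pr_nth; rewrite -(subnK nm) ltn_add2l.
move=> u su; rewrite /mkseq /=; congr (g (_ :: _)); rewrite (iotaDl 1 0 n) -map_comp.
apply: (eq_from_nth (x0 := 0)); first by rewrite size_map size_iota size_drop su subKn.
move=> i; rewrite size_map size_iota => lt.
by rewrite (nth_map 0) ?size_iota // nth_iota // nth_drop.
Qed.

Lemma pr_if n x y z : primrec n x -> primrec n y -> primrec n z ->
  primrec n (fun v => if x v == 0 then y v else z v).
Proof.
apply: (pr_comp3 (phi := fun x y z => if x == 0 then y else z)).
apply: (pr_ext (pr_rec (pr_nth (i := 1) _) (pr_nth (i := 4) _) (pr_nth (i := 0) _))) => //.
by move=> v _; case: (nth 0 v 0).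
Qed.

Lemma pr_add n x y : primrec n x -> primrec n y -> primrec n (fun v => x v + y v).
Proof.
apply: pr_comp2.
apply: (pr_ext (pr_rec (pr_nth (i := 0) _) (pr_succ (pr_nth (i := 1) _)) (pr_nth (i := 1) _))) => //.
by move=> v _; elim: (nth 0 v 1) => [|k /= ->]; rewrite ?addn0 ?addnS.
Qed.

Lemma pr_pred n x : primrec n x -> primrec n (fun v => (x v).-1).
Proof.
apply: (pr_comp1 (phi := predn)).
apply: (pr_ext (pr_rec (pr_cst0 _) (pr_nth (i := 0) _) (pr_nth (i := 0) _))) => //.
by move=> v _; case: (nth 0 v 0).
Qed.

Lemma pr_sub n x y : primrec n x -> primrec n y -> primrec n (fun v => x v - y v).
Proof.
apply: pr_comp2.
apply: (pr_ext (pr_rec (pr_nth (i := 0) _) (pr_pred (pr_nth (i := 1) _)) (pr_nth (i := 1) _))) => //.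
by move=> v _; elim: (nth 0 v 1) => [|k /= ->]; rewrite ?subn0 ?subnS.
Qed.

Lemma pr_iter phi n x k : primrec 1 (fun v => phi (nth 0 v 0)) ->
  primrec n x -> primrec n k -> primrec n (fun v => iter (k v) phi (x v)).
Proof.
move=> H; apply: (pr_comp2 (phi := fun x k => iter k phi x)).
apply: (pr_ext (pr_rec (pr_nth (i := 0) _) (pr_comp1 H (pr_nth (i := 1) _)) (pr_nth (i := 1) _))) => //.
Qed.

Lemma pr_if_leq n x y z t : primrec n x -> primrec n y -> primrec n z -> primrec n t ->
  primrec n (fun v => if x v <= y v then z v else t v).
Proof.
by move=> Hx Hy Hz Ht; exact: (pr_if (pr_sub Hx Hy) Hz Ht).
Qed.

Lemma pr_if_eq n x y z t : primrec n x -> primrec n y -> primrec n z -> primrec n t ->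
  primrec n (fun v => if x v == y v then z v else t v).
Proof.
move=> Hx Hy Hz Ht; apply: (pr_ext (pr_if (pr_add (pr_sub Hx Hy) (pr_sub Hy Hx)) Hz Ht)).
by move=> v _; rewrite addn_eq0 !subn_eq0 -eqn_leq.
Qed.

Definition tri k := nat_rec (fun=> nat) 0 (fun i m => (i + m).+1) k.
Definition pairn x y := Cantor.to_nat (x, y).

Lemma pairnE x y : pairn x y = y + tri (y + x). Proof. by []. Qed.

(** The index of the antidiagonal on which [n] lies, obtained by counting the positive triangular
    numbers up to [n]. *)
Definition diag n :=
  nat_rec (fun=> nat) 0 (fun i acc => acc + (if tri i.+1 <= n then 1 else 0)) n.
Definition sndn n := n - tri (diag n).
Definition fstn n := diag n - sndn n.

Lemma leq_tri k : k <= tri k.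
Proof. by elim: k => //= k IH; rewrite ltnS leq_addr. Qed.

Lemma tri_mono i j : i <= j -> tri i <= tri j.
Proof.
move=> /subnK <-; elim: (j - i) => //= k IH.
by apply: leq_trans IH _; rewrite leqW // leq_addl.
Qed.

Lemma diag_pairn x y : diag (pairn x y) = x + y.
Proof.
pose cnt k := nat_rec (fun=> nat) 0
  (fun i acc => acc + (if tri i.+1 <= pairn x y then 1 else 0)) k.
have cntE k : cnt k = minn k (x + y).
  elim: k => [|k IH]; first by rewrite min0n.
  rewrite /cnt /= -/(cnt k) IH -/(tri k.+1) pairnE addnC [y + x]addnC.
  case: (leqP k.+1 (x + y)) => le.
    by rewrite (leq_trans (tri_mono le)) ?leq_addl // (minn_idPl (ltnW le)).
  have {}le : x + y <= k by [].
  rewrite (minn_idPr le) leqNgt.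
  suff -> : y + tri (x + y) < tri k.+1 by [].
  apply: leq_trans (tri_mono (i := (x + y).+1) _); last by [].
  by rewrite /= ltnS leq_add2r leq_addl.
by rewrite /diag -/(cnt _) cntE; apply/minn_idPr; rewrite pairnE addnC; apply: leq_trans (leq_tri _) (leq_addl _ _).
Qed.

Lemma sndn_pairn x y : sndn (pairn x y) = y.
Proof. by rewrite /sndn diag_pairn pairnE [y + x]addnC addnK. Qed.

Lemma fstn_pairn x y : fstn (pairn x y) = x.
Proof. by rewrite /fstn sndn_pairn diag_pairn addnK. Qed.

Lemma pr_tri n x : primrec n x -> primrec n (fun v => tri (x v)).
Proof.
apply: (pr_comp1 (phi := tri)).
exact: (pr_rec (pr_cst0 _)
  (pr_succ (pr_add (pr_nth (i := 0) _) (pr_nth (i := 1) _))) (pr_nth (i := 0) _)).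
Qed.

Lemma pr_pairn n x y : primrec n x -> primrec n y -> primrec n (fun v => pairn (x v) (y v)).
Proof. by move=> Hx Hy; apply: (pr_add Hy); apply: pr_tri; apply: pr_add. Qed.

Lemma pr_diag n x : primrec n x -> primrec n (fun v => diag (x v)).
Proof.
apply: (pr_comp1 (phi := diag)).
exact: (pr_rec (pr_cst0 _)
  (pr_add (pr_nth (i := 1) _) (pr_if_leq (pr_tri (pr_succ (pr_nth (i := 0) _)))
     (pr_nth (i := 2) _) (pr_cst _ 1) (pr_cst0 _))) (pr_nth (i := 0) _)).
Qed.

Lemma pr_sndn n x : primrec n x -> primrec n (fun v => sndn (x v)).
Proof. by move=> Hx; apply: (pr_sub Hx); apply: pr_tri; apply: pr_diag. Qed.

Lemma pr_fstn n x : primrec n x -> primrec n (fun v => fstn (x v)).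
Proof. by move=> Hx; apply: pr_sub; [apply: pr_diag | apply: pr_sndn]. Qed.

Definition hdn c := fstn c.-1.
Definition tln c := sndn c.-1.

Lemma seq_code_cons x s : seq_code (x :: s) = (pairn x (seq_code s)).+1.
Proof. by []. Qed.

Lemma hdn_code x s : hdn (seq_code (x :: s)) = x.
Proof. by rewrite /hdn seq_code_cons fstn_pairn. Qed.

Lemma tln_code s : tln (seq_code s) = seq_code (behead s).
Proof. by case: s => // x s; rewrite /tln seq_code_cons sndn_pairn. Qed.

Lemma pr_hdn n x : primrec n x -> primrec n (fun v => hdn (x v)).
Proof. by move=> Hx; apply: pr_fstn; apply: pr_pred. Qed.

Lemma pr_tln n x : primrec n x -> primrec n (fun v => tln (x v)).
Proof. by move=> Hx; apply: pr_sndn; apply: pr_pred. Qed.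

Lemma pr_code_cons n x s : primrec n x -> primrec n (fun v => seq_code (s v)) ->
  primrec n (fun v => seq_code (x v :: s v)).
Proof. by move=> Hx Hs; apply: pr_succ; apply: pr_pairn. Qed.

Lemma pr_code_mkseq n N g : primrec n.+1 g -> primrec n N ->
  primrec n (fun v => seq_code (mkseq (fun i => g (i :: v)) (N v))).
Proof.
move=> Hg HN.
have HN2 : primrec n.+2 (fun u => N (drop 2 u)).
  have := pr_comp_cons (m := n.+2) (g := fun u => N (behead u)) _ (pr_cst0 _) (leqW (leqnSn n)).
  rewrite (_ : n.+2 - n = 2) ?subSn ?subnn //; apply.
  apply: (pr_ext (pr_comp (psi := fun i u => nth 0 u i.+1) HN _)).
    by move=> i lt; apply: pr_nth.
  move=> [|x v] //= [sv]; congr N; rewrite -[RHS](mkseq_nth 0) sv.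
  by apply: eq_mkseq.
have Hstep : primrec n.+2 (fun u => (pairn (g ((N (drop 2 u) - nth 0 u 0).-1 :: drop 2 u)) (nth 0 u 1)).+1).
  apply: pr_succ; apply: pr_pairn; last exact: pr_nth.
  have := pr_comp_cons Hg (pr_pred (pr_sub HN2 (pr_nth (n := n.+2) (i := 0) isT))) (leqW (leqnSn n)).
  by rewrite (_ : n.+2 - n = 2) // !subSn ?subnn.
apply: (pr_ext (pr_rec (pr_cst0 _) Hstep HN)) => v sv.
pose G i := g (i :: v).
(* The code is built from its end: after [j] rounds it holds the last [j] entries. *)
suff H j : j <= N v -> nat_rec (fun=> nat) 0 (fun i acc =>
    (pairn (g ((N v - i).-1 :: v)) acc).+1) j = seq_code (map G (iota (N v - j) j)).
  by have := H (N v) (leqnn _); rewrite subnn /= drop0.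
elim: j => [|j IH] lt //=; rewrite IH 1?ltnW //.
by rewrite -subnS -seq_code_cons subnSK.
Qed.

Lemma pr_swap n x : primrec n x -> primrec n (fun v => seq_code (swap_tab (x v))).
Proof.
apply: (pr_comp1 (phi := fun k => seq_code (swap_tab k))).
apply: (pr_code_mkseq (g := fun v => swapf (nth 0 v 1) (nth 0 v 0))); last by apply/pr_succ/pr_nth.
by apply: (pr_if (pr_nth _) (pr_nth _)) => //; apply: pr_if_eq; try exact: pr_nth; exact: pr_cst0.
Qed.

Definition nthn t i := if iter i tln t == 0 then i else hdn (iter i tln t).

Lemma nthn_code t i : nthn (seq_code t) i = perm_at t i.
Proof.
have -> : nthn (seq_code t) i =
    if seq_code (drop i t) == 0 then i else hdn (seq_code (drop i t)).
  rewrite /nthn; suff -> : iter i tln (seq_code t) = seq_code (drop i t) by [].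
  by elim: i => [|i IH]; rewrite ?drop0 //= IH tln_code -drop1 drop_drop.
rewrite /perm_at; case: (ltnP i (size t)) => lt; last by rewrite drop_oversize ?nth_default.
by rewrite (drop_nth i lt) hdn_code.
Qed.

(** Here [t] is the code of a table. It bounds the length of that table, so [l + t] entries suffice;
    later positions are fixed points. *)
Definition shift_tab l t := mkseq (fun i => if l <= i then l + nthn t (i - l) else i) (l + t).

Lemma pr_shift n l t : primrec n l -> primrec n t ->
  primrec n (fun v => seq_code (shift_tab (l v) (t v))).
Proof.
apply: (pr_comp2 (phi := fun l t => seq_code (shift_tab l t))).
apply: (pr_code_mkseq (g := fun v => if nth 0 v 1 <= nth 0 v 0
   then nth 0 v 1 + nthn (nth 0 v 2) (nth 0 v 0 - nth 0 v 1) else nth 0 v 0));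
  last by apply: pr_add; exact: pr_nth.
have Hi : primrec 3 (fun v => iter (nth 0 v 0 - nth 0 v 1) tln (nth 0 v 2)).
  apply: pr_iter; [by apply/pr_tln/pr_nth|exact: pr_nth|by apply: pr_sub; exact: pr_nth].
apply: pr_if_leq; try exact: pr_nth.
apply: pr_add; first exact: pr_nth.
by apply: pr_if (pr_hdn Hi) => //; apply: pr_sub; exact: pr_nth.
Qed.

Lemma size_leq_code s : size s <= seq_code s.
Proof.
elim: s => // x s IH; rewrite seq_code_cons ltnS; apply: leq_trans IH _.
by rewrite pairnE leq_addr.
Qed.

Lemma perm_at_shift l t i :
  perm_at (shift_tab l (seq_code t)) i = if l <= i then l + perm_at t (i - l) else i.
Proof.
rewrite /perm_at; case: (ltnP i (l + seq_code t)) => lt.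
  by rewrite nth_mkseq // nthn_code.
rewrite nth_default ?size_mkseq // (leq_trans (leq_addr _ _) lt).
rewrite nth_default ?subnKC //; first by rewrite (leq_trans (leq_addr _ _) lt).
by rewrite (leq_trans (size_leq_code t)) // leq_subRL // (leq_trans (leq_addr _ _) lt).
Qed.

Lemma permutes_shift l t n : permutes t n -> permutes (shift_tab l (seq_code t)) (l + n).
Proof.
move=> pt; rewrite /permutes (eq_map (perm_at_shift l t)) iotaD map_cat perm_cat //.
  rewrite (_ : map _ _ = iota 0 l) // -[RHS]map_id; apply/eq_in_map => i.
  by rewrite mem_iota add0n => /andP[_ lt]; rewrite leqNgt lt.
have -> : iota (0 + l) n = map (addn l) (iota 0 n) by rewrite -iotaDl addn0.
set s := map _ _; have -> : s = map (addn l) (map (perm_at t) (iota 0 n)).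
  by rewrite /s -!map_comp; apply: eq_map => i; rewrite /= leq_addr addKn.
exact: perm_map.
Qed.

Lemma permuted_shift A (x0 : A) gs s t :
  permuted x0 (shift_tab (size gs) (seq_code t)) (gs ++ s) = gs ++ permuted x0 t s.
Proof.
rewrite /permuted size_cat iotaD map_cat; congr (_ ++ _).
  rewrite -[RHS]take_size -(map_nth_iota0 x0) //; apply/eq_in_map => i.
  rewrite mem_iota add0n => /andP[_ lt].
  by rewrite perm_at_shift leqNgt lt nth_cat lt.
have -> : iota (0 + size gs) (size s) = map (addn (size gs)) (iota 0 (size s)).
  by rewrite -iotaDl addn0.
rewrite -map_comp; apply: eq_map => i; rewrite /= perm_at_shift leq_addr nth_cat ltnNge leq_addr /=.
by rewrite !addKn.
Qed.
(** * The total operator simulating a partial induction *)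

(* [h] is of the form M :: u, where u is the set of codes: hence the shift. *)
Definition slice (h : nat -> nat) (N : nat) : Cantor_space := fun m => 0 < h (pairn m N).+1.

Definition below (h : nat -> nat) (M N : nat) := exists2 m, M = m.+1 & slice h N m.

Definition empty : Cantor_space := fun=> false.

(** Unions of sets among the empty set, [X] and [Y] stay among them, so [g] is one of the three.
    Closure makes it a fixed point, and the empty set or [X] is fixed only if it equals [Y]. Testing
    [u = X] first covers an empty [X]. *)
Lemma one_step_induction (phi : (nat -> nat) -> nat) (X Y g : Cantor_space) :
  incl X Y ->
  (forall u, op_step phi u =
     if `[< u = X >] then Y else if `[< u = empty >] then X else u) ->
  (forall n, 0 < phi (prepend n g) -> g n) ->
  (forall Q : Cantor_space -> Prop,
      (forall f, Q f -> Q (op_step phi f)) ->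
      (forall P, (forall f, P f -> Q f) -> Q (union P)) -> Q g) ->
  g = Y.
Proof.
move=> XY step cl ad.
have fix_g : op_step phi g = g.
  by apply: incl_anti => n; rewrite /op_step; [case/orP => // /cl | move=> ->].
pose Q u := [\/ u = empty, u = X | u = Y].
have : Q g.
  apply: (ad Q) => [u Qu|P PQ]; rewrite /Q.
    rewrite step; case: asboolP => [_|uX]; first by constructor 3.
    by case: asboolP => [_|uE]; first by constructor 2.
  have [PY|nPY] := pselect (P Y).
    constructor 3; apply: incl_anti; last exact: union_sup.
    by apply: union_least => u /PQ[] ->.
  have [PX|nPX] := pselect (P X).
    constructor 2; apply: incl_anti; last exact: union_sup.
    by apply: union_least => u Pu; case: (PQ _ Pu) => e; rewrite e // in Pu *.
  constructor 1; apply: incl_anti => // n /unionP[u Pu].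
  by case: (PQ _ Pu) => e; rewrite e // in Pu *.
case=> // e; move: fix_g; rewrite step e.
  case: asboolP => [-> //|ne]; case: asboolP => // _ Xe; case: ne.
  by rewrite Xe.
by case: asboolP.
Qed.

Section Programs.
Variables pairi fsti sndi neqi swapi predi : nat.
Hypothesis pairiP : forall F f x y r, K pairi F f (x :: y :: r) (pairn x y).
Hypothesis fstiP : forall F f x r, K fsti F f (x :: r) (fstn x).
Hypothesis sndiP : forall F f x r, K sndi F f (x :: r) (sndn x).
Hypothesis neqiP : forall F f x y r, K neqi F f (x :: y :: r) (x != y).
Hypothesis swapiP : forall F f l i r, K swapi F f (l :: i :: r) (funswap l i).
Hypothesis prediP : forall F f x r, K predi F f (x :: r) x.-1.

Definition mem_slice k := lett pairi (ifz (appf k (succ_ (var 0))) (cst 0) (cst 1)).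

Lemma K_mem_slice F f k h s m N r : drop k f = h :: s ->
  K (mem_slice k) F f (m :: N :: r) (slice h N m).
Proof.
move=> e; apply: K_let (pairiP _ _ _ _ _) _.
eapply K_ifz; first by eapply K_appf; [exact: e|krun].
  by rewrite /slice => ->; krun.
by rewrite /slice => ->; krun.
Qed.

(* The programs below receive the numbers t, d, kappa, lambda after their own
   arguments: t is an index of the translation, d the source index, and kappa
   (lambda) the number of numbers (functions) between them (the function h) and
   the arguments of the source computation. *)
Definition next_call :=
  call (lett
    (lett (var 3) (lett (addc 6 (var 5)) (lett (succ_ (var 7)) (call (var 5)))))
    (lett (succ_ (var 6)) swapi)).

(* The stages are 0, X, X U F(X), where X is the slice of h at N: this is how a
   computed set X becomes an actual function argument of d. *)
Definition next_body :=
  ifz (exq (lett (appf 0 (cst 0))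
         (lett (lett (var 2) (lett (var 1) (mem_slice 2)))
            (lett (appf 1 (succ_ (var 1))) neqi))))
    next_call
    (ifz (exq (appf 1 (succ_ (appf 0 (cst 0)))))
       (lett (var 1) (lett (appf 0 (cst 0)) (mem_slice 1)))
       (cst 0)).

Definition nexti := ind next_body (var 0).

(** The number z = <z1, z2> codes a possible defect of the slice at N. The order of the tests
    matters: [next] runs only after the slice at z1 + 1 has been accepted. The offset 9 counts the
    numbers z2, z1, z, [legiti], N, t, d, kappa, lambda that become extra arguments; lambda grows by
    the function introduced by [exq]. *)
Definition legit_bad (next : nat) :=
  lett fsti (lett (lett (var 1) sndi)
    (ifz (lett (var 4) (lett (var 2) (mem_slice 0)))
      (cst 0)
      (ifz (lett (succ_ (var 8)) (lett (addc 9 (var 8)) (lett (var 8) (lett (var 8)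
              (lett (succ_ (var 5)) (lett (var 8) (call (var 0))))))))
        (cst 1)
        (ifz (lett (succ_ (var 8)) (lett (addc 9 (var 8)) (lett (var 8) (lett (var 8)
                (lett (succ_ (var 5)) (lett (var 6) next))))))
          (cst 1)
          (ifz (lett (succ_ (var 8)) (lett (addc 9 (var 8)) (lett (var 8) (lett (var 8)
                  (lett (succ_ (var 5)) (lett (var 5) next))))))
            (cst 0)
            (ifz (lett (var 4) (lett (var 1) (mem_slice 0))) (cst 1) (cst 0))))))).

(* [legiti] receives its own index as first argument. *)
Definition legiti :=
  ifz (exq (lett (appf 0 (cst 0)) (funswap 1 (legit_bad nexti)))) (cst 1) (cst 0).

(** The accessible part of [below] is itself inductively generated: N enters once every m + 1 below
    it has. This operator is total for every h, and it guards the recursion of [legiti]. *)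
Definition wfi :=
  ind (ifz (exq (lett (appf 1 (cst 0)) (lett (appf 0 (cst 0))
         (ifz (mem_slice 2) (cst 0)
            (ifz (appf 1 (succ_ (succ_ (var 0)))) (cst 1) (cst 0))))))
       (cst 1) (cst 0)) (cst 0).

Lemma K_wfi F f a h : K wfi F (h :: f) a `[< Acc (below h) 0 >].
Proof.
pose p h1 := nat_of_bool (~~ `[< exists m, slice h (h1 0) m && (h1 m.+2 == 0) >]).
have [||g [Kg cl ad]] := @K_ind F (h :: f) a (ifz (exq (lett (appf 1 (cst 0)) (lett (appf 0 (cst 0))
         (ifz (mem_slice 2) (cst 0)
            (ifz (appf 1 (succ_ (succ_ (var 0)))) (cst 1) (cst 0))))))
       (cst 1) (cst 0)) (cst 0) p 0; [|by krun|].
  move=> h1; eapply K_ifz.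
  - apply: (K_exq (chi := fun m => slice h (h1 0) m && (h1 m.+2 == 0))) => h2.
    apply: K_let; first by krun.
    apply: K_let; first by krun.
    eapply K_ifz; first by apply: K_mem_slice; reflexivity.
      by case: (slice _ _ _) => // _; krun.
    case: (slice _ _ _) => // _; eapply K_ifz; first by krun.
      by move=> ->; krun.
    by case: (h1 _) => // n _; krun.
  - rewrite /p; case: asboolP => // ne _.
    case: asboolP => [[m mP]|_]; last by krun.
    by case: ne; exists m; case: (_ && _) mP.
  - rewrite /p; case: asboolP => // -[m mP] _.
    case: asboolP => [_|ne]; first by krun.
    by case: ne; exists m; case: (_ && _) mP.
suff <- : g 0 = `[< Acc (below h) 0 >] by [].
apply/idP/asboolP => [|acc0].
  apply: (ad (fun u => forall N, u N -> Acc (below h) N)) => [u IH N|P IH N].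
    case/orP => [/IH //|]; rewrite /p lt0b => /asboolPn no.
    constructor=> _ [m -> Bm]; apply: IH; apply: contrapT => um; apply: no.
    by exists m; rewrite Bm /=; case: (u _) um.
  by case/unionP => u /IH; apply.
elim: acc0 => N _ IH; apply: cl; rewrite /p lt0b; apply/asboolPn => -[m /andP[Bm]] /=.
by rewrite IH //; exists m.
Qed.

Section Simulation.
Variables (F : seq ((nat -> nat) -> nat)) (f : seq (nat -> nat)) (a : seq nat).
Variables (t d : nat) (T : nat -> nat -> nat).
Hypothesis tP : forall l k F f r, K t F f (l :: k :: d :: r) (T l k).
(** [stg] stands for the genuine stages. [next] is a total function of sets, but [T_stg] ties it to
    computations on stages only. *)
Variables (stg : Cantor_space -> Prop) (next : Cantor_space -> Cantor_space).
Hypothesis next_incl : forall X, incl X (next X).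
Hypothesis stg_next : forall X, stg X -> stg (next X).
Hypothesis stg_union : forall P : Cantor_space -> Prop,
  (forall X, P X -> stg X) -> stg (union P).
Hypothesis T_stg : forall X y, stg X -> exists2 c, next X y = X y || (0 < c) &
  forall gs xs, K (T (size gs) (size xs)) F (gs ++ prepend y X :: f) (xs ++ a) c.

(** The translated index expects its function argument just before [f], so [h1] is swapped behind
    [h] and [js], which makes lambda + 1 extra functions. The 6 extra numbers are x, N, t, d, kappa,
    lambda. *)
Lemma K_next_call h h1 js ys x N X y c :
  (forall gs xs, K (T (size gs) (size xs)) F (gs ++ prepend y X :: f) (xs ++ a) c) ->
  h1 = prepend y X ->
  K next_call F (h1 :: h :: js ++ f)
    ([:: x, N, t, d, size ys, size js & ys ++ a]) c.
Proof.
move=> H ->; eapply K_call.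
  apply: K_let; first do 3 (apply: K_let; first by krun).
    by eapply K_call; [krun | apply: tP].
  apply: K_let; first by krun.
  exact: swapiP.
apply: K_funswap; first by rewrite /= size_cat ltnS leq_addr.
have [js' sj e] := permuted_swap_mid (fun=> 0) (h :: js) (prepend y X) f.
have := H js' [:: x, N, t, d, size ys, size js & ys].
by rewrite sj -e.
Qed.

Lemma K_nexti h js ys x N : stg (slice h N) ->
  K nexti F (h :: js ++ f) ([:: x, N, t, d, size ys, size js & ys ++ a])
    (next (slice h N) x).
Proof.
move=> sX; set X := slice h N; set as_ := [:: x, N, t, d, size ys, size js & ys ++ a].
have /choice[c cP] : forall y, exists c, next X y = X y || (0 < c) /\
  forall gs xs, K (T (size gs) (size xs)) F (gs ++ prepend y X :: f) (xs ++ a) c.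
  by move=> y; have [c] := T_stg y sX; exists c.
pose differs (h1 : nat -> nat) := `[< exists z, 0 < (h1 z.+1 != X z) >].
pose nonempty (h1 : nat -> nat) := `[< exists z, 0 < h1 z.+1 >].
pose p h1 := if differs h1 then (if nonempty h1 then 0 else nat_of_bool (X (h1 0)))
  else c (h1 0).
have differsP u n : differs (prepend n u) = ~~ `[< u = X >].
  apply/asboolP/asboolPn => [[z /=] + e|ne]; first by rewrite e eqxx.
  apply: contrapT => no; apply: ne; apply/funext => z; apply: contrapT => uz.
  by apply: no; exists z => /=; move: uz; case: (u z); case: (X z).
have nonemptyP u n : nonempty (prepend n u) = ~~ `[< u = empty >].
  apply/asboolP/asboolPn => [[z /=] + e|ne]; first by rewrite e.
  apply: contrapT => no; apply: ne; apply/funext => z; apply: contrapT => uz.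
  by apply: no; exists z => /=; case: (u z) uz.
have [||g [Kg cl ad]] := @K_ind F (h :: js ++ f) as_ next_body (var 0) p x; [|by krun|].
- move=> h1; eapply K_ifz.
  + apply: (K_exq (chi := fun z => (h1 z.+1 != X z))) => h2.
    apply: K_let; first by krun.
    apply: K_let.
      apply: K_let; first by krun.
      apply: K_let; first by krun.
      by apply: K_mem_slice; reflexivity.
    apply: K_let; first by krun.
    exact: neqiP.
  + rewrite -/(differs h1) /p; case e: (differs h1) => // _.
    apply: (@K_next_call _ _ _ _ _ _ X (h1 0)); first by case: (cP (h1 0)).
    apply/funext => -[//|z] /=; apply: contrapT => ne.
    by move/asboolPn: e; apply; exists z; case: eqP.
  + rewrite -/(differs h1) /p; case e: (differs h1) => // _.
    eapply K_ifz.
    * apply: (K_exq (chi := fun z => h1 z.+1)) => h2; krun.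
    * rewrite -/(nonempty h1); case: (nonempty h1) => // _.
      apply: K_let; first by krun.
      apply: K_let; first by krun.
      by apply: (@K_mem_slice _ _ 1 h (js ++ f)).
    * by rewrite -/(nonempty h1); case: (nonempty h1) => // _; krun.
suff <- : g = next X by [].
apply: (one_step_induction (@next_incl X) _ cl ad) => u.
apply/funext => n; rewrite /op_step /p differsP nonemptyP.
case: (asboolP (u = X)) => [->|_] /=; first by case: (cP n) => ->.
case: asboolP => [->|_] /=; last by rewrite orbF.
by rewrite lt0b.
Qed.

(** The last two clauses split the equation between the slice and the union into pointwise
    conditions, whose failure a single search over pairs detects. *)
Inductive legit (h : nat -> nat) (N : nat) : Prop := Legit of
  (forall m, slice h N m -> legit h m.+1) &
  (forall m, slice h N m -> next (slice h m.+1) m) &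
  (forall m, slice h N m -> incl (next (slice h m.+1)) (slice h N)).

Lemma legit_stg h N : legit h N -> stg (slice h N).
Proof.
elim=> {}N _ IH own inc.
have -> : slice h N = union (fun X => exists2 m, slice h N m & X = next (slice h m.+1)).
  apply: incl_anti => n.
    by move=> Bn; apply/unionP; exists (next (slice h n.+1)); [exists n | apply: own].
  by case/unionP => _ [m Bm ->]; apply: inc.
by apply: stg_union => _ [m /IH sm ->]; apply: stg_next.
Qed.

Lemma legit_acc h N : legit h N -> Acc (below h) N.
Proof. by elim=> {}N _ IH _ _; constructor=> _ [m -> /IH]. Qed.

Lemma K_legit_bad h h2 js ys N z :
  let z1 := fstn z in let z2 := sndn z in
  let m := z1.+1 in
  (slice h N z1 -> forall js ys,
     K legiti F (h :: js ++ f)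
       ([:: legiti, m, t, d, size ys, size js & ys ++ a]) `[< legit h m >]) ->
  K (legit_bad nexti) F (h :: h2 :: js ++ f)
    ([:: z, legiti, N, t, d, size ys, size js & ys ++ a])
    (slice h N z1 && ~~ [&& `[< legit h m >], next (slice h m) z1 &
                        next (slice h m) z2 ==> slice h N z2]).
Proof.
move=> z1 z2 m IH.
have Knext x : legit h m ->
    K nexti F (h :: h2 :: js ++ f) [:: x, m, t, d, (size ys) .+1.+4.+4,
      (size js).+1, z2, z1, z, legiti, N, t, d, size ys, size js & ys ++ a]
      (next (slice h m) x).
  move=> /legit_stg sm.
  exact: (K_nexti (h2 :: js) [:: z2, z1, z, legiti, N, t, d, size ys, size js & ys] x sm).
apply: K_let (fstiP _ _ _ _) _; apply: K_let.
  by apply: K_let; [krun | apply: sndiP].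
eapply K_ifz.
- apply: K_let; first by krun.
  by apply: K_let; [krun | apply: (@K_mem_slice _ _ 0 h (h2 :: js ++ f))].
- by rewrite -/z1; case: (slice _ _ _) => // _; krun.
rewrite -/z1; case e: (slice _ _ _) => // _; eapply K_ifz.
- do 6 (apply: K_let; first by krun).
  apply: K_call; first by krun.
  exact: (IH e (h2 :: js) [:: z2, z1, z, legiti, N, t, d, size ys, size js & ys]).
- by case: asboolP => // _ _; krun.
case: asboolP => // lm _; eapply K_ifz.
- do 6 (apply: K_let; first by krun).
  exact: Knext.
- by rewrite -/z1 -/m; case: (next _ _) => // _; krun.
rewrite -/z1 -/m; case: (next _ z1) => // _; eapply K_ifz.
- do 6 (apply: K_let; first by krun).
  exact: Knext.
- by rewrite -/z2 -/m; case: (next _ _) => // _; krun.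
rewrite -/z2 -/m; case: (next _ z2) => // _; eapply K_ifz.
- apply: K_let; first by krun.
  by apply: K_let; [krun | apply: (@K_mem_slice _ _ 0 h (h2 :: js ++ f))].
- by rewrite -/z2; case: (slice _ _ _) => // _; krun.
by rewrite -/z2; case: (slice _ _ _) => // _; krun.
Qed.

Lemma K_legiti h N : Acc (below h) N -> forall js ys,
  K legiti F (h :: js ++ f)
    ([:: legiti, N, t, d, size ys, size js & ys ++ a]) `[< legit h N >].
Proof.
elim=> {}N _ IH js ys.
pose bad z := slice h N (fstn z) && ~~ [&& `[< legit h (fstn z).+1 >],
  next (slice h (fstn z).+1) (fstn z) & next (slice h (fstn z).+1) (sndn z) ==> slice h N (sndn z)].
have badP : (exists z, 0 < nat_of_bool (bad z)) <-> ~ legit h N.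
  split=> [[z]|nl].
    rewrite lt0b => /andP[Bz /negP nb] [l1 l2 l3]; apply: nb.
    apply/and3P; split; [by apply/asboolP/l1|exact: l2|apply/implyP; exact: l3].
  apply: contrapT => nb.
  have good z : slice h N (fstn z) -> [&& `[< legit h (fstn z).+1 >],
      next (slice h (fstn z).+1) (fstn z) & next (slice h (fstn z).+1) (sndn z) ==> slice h N (sndn z)].
    move=> Bz; apply: contrapT => /negP ng; apply: nb; exists z.
    by rewrite lt0b /bad Bz.
  apply: nl; constructor=> m Bm.
  - by have := good (pairn m 0); rewrite fstn_pairn => /(_ Bm) /and3P[/asboolP].
  - by have := good (pairn m 0); rewrite fstn_pairn => /(_ Bm) /and3P[].
  - move=> x nx; have := good (pairn m x).
    by rewrite fstn_pairn sndn_pairn => /(_ Bm) /and3P[_ _ /implyP]; apply.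
eapply K_ifz.
- apply: (K_exq (chi := fun z => bad z)) => h2.
  apply: K_let; first by krun.
  apply: K_funswap => //.
  have -> : permuted (fun=> 0) (swap_tab 1) [:: h2, h & js ++ f] = [:: h, h2 & js ++ f].
    rewrite /permuted /=; congr [:: _, _ & _].
    rewrite -[RHS](mkseq_nth (fun=> 0)) /mkseq (iotaDl 2 0) -map_comp.
    by apply: eq_map => i; rewrite /= perm_at_swap.
  apply: K_legit_bad => Bz js' ys'; apply: IH.
  by exists (fstn (h2 0)).
- case: asboolP => // nb _; case: asboolP => [_|/badP //]; krun.
- by case: asboolP => // /badP nl _; case: asboolP => // _; krun.
Qed.

(** Each test makes the next one converge: well-foundedness that of [legiti], acceptance that of
    [nexti] on the slice at 0. *)
Definition stage_op :=
  ifz wfi (cst 0)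
    (ifz (lett (var 3) (lett (addc 4 (var 3)) (lett (var 3) (lett (var 3)
            (lett (cst 0) (lett (cst legiti) legiti))))))
      (cst 0)
      (lett (appf 0 (cst 0)) (lett fsti (lett (lett (var 1) sndi)
        (ifz (var 0)
          (lett (var 6) (lett (addc 7 (var 6)) (lett (var 6) (lett (var 6)
             (lett (cst 0) (lett (var 6) nexti))))))
          (lett (lett (var 0) predi)
            (ifz (lett (cst 0) (lett (var 1) (mem_slice 0)))
              (ifz (lett (var 7) (lett (addc 8 (var 7)) (lett (var 7) (lett (var 7)
                      (lett (cst 0) (lett (var 5) nexti))))))
                (cst 0)
                (lett (cst 0) (lett (var 3) (mem_slice 0))))
              (cst 0)))))))).

(** A slice at n + 1 is written only at the step where n enters; afterwards n is a member and the
    slice is frozen. *)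
Definition extend (h : nat -> nat) (M : nat) : bool :=
  let m := fstn M in
  if sndn M is n.+1 then [&& ~~ slice h 0 n, next (slice h 0) n & slice h 0 m]
  else next (slice h 0) m.

Lemma K_stage_op h js ys :
  K stage_op F (h :: js ++ f) ([:: t, d, size ys, size js & ys ++ a])
    (`[< legit h 0 >] && extend h (h 0)).
Proof.
eapply K_ifz; first exact: K_wfi.
  case: asboolP => // na _; case: asboolP => [/legit_acc //|_]; krun.
case: asboolP => // /K_legiti Kl _; eapply K_ifz.
- do 6 (apply: K_let; first by krun).
  exact: (Kl js [:: t, d, size ys, size js & ys]).
- by case: asboolP => // _ _; krun.
case: asboolP => // /legit_stg st0 _.
apply: K_let; first by krun.
apply: K_let (fstiP _ _ _ _) _; apply: K_let.
  by apply: K_let; [krun | apply: sndiP].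
rewrite /extend; set m := fstn _; set N := sndn _.
eapply K_ifz; first by krun.
  move=> ->; do 6 (apply: K_let; first by krun).
  exact: (K_nexti js [:: 0, m, h 0, t, d, size ys, size js & ys] m st0).
case: N => // n _; apply: K_let.
  by apply: K_let; [krun | apply: prediP].
eapply K_ifz.
- apply: K_let; first by krun.
  by apply: K_let; [krun | apply: (@K_mem_slice _ _ 0 h (js ++ f))].
- case: (slice _ _ n) => // _; eapply K_ifz.
  + do 6 (apply: K_let; first by krun).
    exact: (K_nexti js [:: n, n.+1, m, h 0, t, d, size ys, size js & ys] n st0).
  + by case: (next _ n) => // _; krun.
  case: (next _ n) => // _; apply: K_let; first by krun.
  by apply: K_let; [krun | apply: (@K_mem_slice _ _ 0 h (js ++ f))].
- by case: (slice _ _ n) => // _; krun.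
Qed.

End Simulation.

End Programs.

(** * Translation of indices *)

Section CodedStages.
Variables (next : Cantor_space -> Cantor_space).
Variables (W : Type) (lt : W -> W -> Prop) (R : Cantor_space -> Cantor_space -> Prop).
Variable (s : W -> Cantor_space).
Hypothesis wo : well_order lt.
Hypothesis st : stages R lt s.
Hypothesis nextP : forall X g, R X g -> next X = (fun n => X n || g n).

(** A closed form of the history: since stages increase, the stage at which n is about to enter is
    the union of all stages without n. *)
Definition coded_stage (v : W) : Cantor_space := fun M =>
  if sndn M is n.+1 then s v n && `[< exists2 w, s w (fstn M) & ~~ s w n >]
  else s v (fstn M).

Lemma coded_stage0 v m : coded_stage v (pairn m 0) = s v m.
Proof. by rewrite /coded_stage sndn_pairn fstn_pairn. Qed.

Lemma coded_stageS v m n : coded_stage v (pairn m n.+1) =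
  s v n && `[< exists2 w, s w m & ~~ s w n >].
Proof. by rewrite /coded_stage sndn_pairn fstn_pairn. Qed.

Lemma slice_prepend p u N m : slice (prepend p u) N m = u (pairn m N).
Proof. by rewrite /slice /= lt0b. Qed.

Lemma slice_coded0 p v : slice (prepend p (coded_stage v)) 0 = s v.
Proof. by apply/funext => m; rewrite slice_prepend coded_stage0. Qed.

(** The stages without [n] are all included in [s w], and [s w] is one of them. *)
Lemma before_entry w w' n m : is_next lt w w' -> ~~ s w n -> s w' n ->
  (exists2 u, s u m & ~~ s u n) <-> s w m.
Proof.
move=> ww' wn w'n; split=> [[u um un]|wm]; last by exists w.
case: (wo) => _ _ /(_ u w)[/(stages_mono wo st)|<- //|wu]; first exact.
by move: un; rewrite (stages_mono_le wo st (next_le wo ww' wu)).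
Qed.

(** A member m of [s w] entered from some [s u] with u before w, and the slice at m + 1 is that
    [s u]; hence induction on w. *)
Lemma legit_coded p v N w : w = v \/ lt w v ->
  slice (prepend p (coded_stage v)) N = s w -> legit next (prepend p (coded_stage v)) N.
Proof.
have lt_wf : well_founded lt by case: wo.
have lt_tr x y z : lt x y -> lt y z -> lt x z by case: wo => _ tr _; apply: tr.
elim/(well_founded_ind lt_wf): w N => w IH N wv BN.
have H m : s w m -> exists u u', [/\ lt u w, is_next lt u u', s u' m,
    incl (s u') (s w) & slice (prepend p (coded_stage v)) m.+1 = s u].
  move=> wm; have [u [u' [uu' um u'm u'w]]] := stages_entry wo st wm.
  exists u, u'; split=> //; first 1 last.
  - exact: (stages_mono_le wo st u'w).
  - apply/funext => k; rewrite slice_prepend coded_stageS.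
    rewrite (stages_mono_le wo st wv wm) /=.
    have e := before_entry k uu' um u'm.
    by apply/idP/idP => [/asboolP/e|/e/asboolP].
  case: uu' => uu' _; case: u'w => [<-//|]; exact: lt_tr uu'.
have nx u u' : is_next lt u u' -> next (s u) = s u'.
  by move=> /(stages_next st)[g Rg ->]; apply: nextP.
split=> m; rewrite BN => /H[u [u' [uw uu' u'm inc Bm]]].
- apply: (IH u) => //; right; case: wv => [<- //|]; exact: lt_tr uw.
- by rewrite Bm (nx _ _ uu').
- by rewrite Bm (nx _ _ uu').
Qed.

Lemma coded_stages : stages
  (operator_of (fun h c => c = (`[< legit next h 0 >] && extend next h (h 0) : nat)))
  lt coded_stage.
Proof.
case: (st) => zr _ lm; split.
- move=> v z M; rewrite /coded_stage; case: (sndn M) => [|n]; by rewrite zr.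
- move=> w v wv; exists (fun M => extend next (prepend M (coded_stage w)) M).
    move=> M; exists (extend next (prepend M (coded_stage w)) M : nat); last by case: (extend _ _ _).
    have -> : `[< legit next (prepend M (coded_stage w)) 0 >] = true by
      apply/asboolP/(legit_coded (w := w)); [left | rewrite slice_coded0].
    by [].
  have [g Rg sv] := stages_next st wv.
  have nx : next (s w) = s v by rewrite (nextP Rg).
  move=> M; rewrite /extend slice_coded0 nx /coded_stage.
  case: (sndn M) => [|n]; first by rewrite sv orbA orbb.
  (* If [n] is already in [s w], its slice stays unchanged; otherwise it is written now, with
     content [s w]. *)
  case wn: (s w n) => /=; first by rewrite (stages_mono wo st (proj1 wv)) ?orbF.
  case vn: (s v n) => //=.
  have e := before_entry (fstn M) wv (negbT wn) vn.
  by apply/asboolP/idP => /e.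
- move=> v l M; rewrite /coded_stage; case: (sndn M) => [|n]; first exact: lm.
  split=> [/andP[/(lm _ l)[w wv wn] e]|[w wv /andP[wn ->]]]; first by exists w; rewrite ?wn.
  by rewrite andbT; apply/(lm _ l); exists w.
Qed.

End CodedStages.

(* Translates d at run time, so that [translate] needs no recursion. *)
Definition delayed t l k d :=
  call (lett (cst d) (lett (cst k) (lett (cst l) (call (cst t))))).

(** Numbers bound by S4 or S8.2 arrive in front of the [k] extras and are swapped behind them. In
    S8.3 and S9 the source consumes a number that cannot be discarded, so it joins the extras: hence
    [k.+1]. In [5 + k], the 5 counts the pushed l, k + 1, d, t and 0; the query <x, 0> reads slice 0
    of the final history. *)
Definition translate (pairi op t l k e : nat) : nat :=
  let arg i := hdn (iter i tln e) in
  if hdn e == 1 then numswap k (seq_code [:: 1])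
  else if hdn e == 2 then e
  else if hdn e == 3 then var k
  else if hdn e == 4 then lett (delayed t l k (arg 2)) (numswap k (delayed t l k (arg 1)))
  else if hdn e == 6 then
    seq_code [:: 6; delayed t l k (arg 1); arg 2; seq_code (shift_tab l (arg 3));
      seq_code (shift_tab k (arg 4))]
  else if hdn e == 7 then
    seq_code [:: 6; seq_code [:: 7]; 0; seq_code (swap_tab l); seq_code (swap_tab k)]
  else if hdn e == 8 then
    if arg 1 == 2 then seq_code [:: 8; 2; numswap k (delayed t l k (arg 2))]
    else lett (cst l) (lett (cst k.+1) (lett (cst (arg 2)) (lett (cst t)
      (ind op (lett (cst 0) (lett (var (5 + k)) pairi))))))
  else call (lett (var k) (lett (cst k.+1) (lett (cst l) (call (cst t))))).

(* Primitive recursiveness of the translation *)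
Transparent cst lett succ_ numswap funswap var appf ind call.

Section PrimrecCodes.
Variables (n : nat).
Implicit Types x y z : seq nat -> nat.

Lemma pr_code1 x : primrec n x -> primrec n (fun v => seq_code [:: x v]).
Proof. by move=> Hx; apply: (pr_code_cons (s := fun=> [::])) => //; exact: pr_cst0. Qed.

Lemma pr_code2 x y : primrec n x -> primrec n y -> primrec n (fun v => seq_code [:: x v; y v]).
Proof. by move=> Hx Hy; apply: (pr_code_cons (s := fun v => [:: y v])) => //; exact: pr_code1. Qed.

Lemma pr_code3 x y z : primrec n x -> primrec n y -> primrec n z ->
  primrec n (fun v => seq_code [:: x v; y v; z v]).
Proof. by move=> Hx Hy Hz; apply: (pr_code_cons (s := fun v => [:: y v; z v])) => //; exact: pr_code2. Qed.

Lemma pr_code5 x y z x' y' : primrec n x -> primrec n y -> primrec n z ->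
  primrec n x' -> primrec n y' ->
  primrec n (fun v => seq_code [:: x v; y v; z v; x' v; y' v]).
Proof.
move=> Hx Hy *; apply: (pr_code_cons (s := fun v => [:: y v; z v; x' v; y' v])) => //.
by apply: (pr_code_cons (s := fun v => [:: z v; x' v; y' v])) => //; exact: pr_code3.
Qed.

Lemma pr_cstc x : primrec n x -> primrec n (fun v => cst (x v)).
Proof. by move=> Hx; apply: pr_code2 => //; exact: pr_cst. Qed.

Lemma pr_lett x y : primrec n x -> primrec n y -> primrec n (fun v => lett (x v) (y v)).
Proof. by move=> Hx Hy; apply: pr_code3 => //; exact: pr_cst. Qed.

Lemma pr_call x : primrec n x -> primrec n (fun v => call (x v)).
Proof. by move=> Hx; apply: pr_code3 => //; exact: pr_cst. Qed.

Lemma pr_numswap x y : primrec n x -> primrec n y -> primrec n (fun v => numswap (x v) (y v)).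
Proof. by move=> Hx Hy; apply: pr_code5 => //; try exact: pr_cst; exact: pr_swap. Qed.

Lemma pr_funswap x y : primrec n x -> primrec n y -> primrec n (fun v => funswap (x v) (y v)).
Proof. by move=> Hx Hy; apply: pr_code5 => //; try exact: pr_cst; exact: pr_swap. Qed.

Lemma pr_var x : primrec n x -> primrec n (fun v => var (x v)).
Proof. by move=> Hx; apply: pr_numswap => //; exact: pr_cst. Qed.

Lemma pr_ind q x : primrec n x -> primrec n (fun v => ind q (x v)).
Proof. by move=> Hx; apply: pr_lett => //; exact: pr_cst. Qed.

Lemma pr_delayed t l k d : primrec n t -> primrec n l -> primrec n k -> primrec n d ->
  primrec n (fun v => delayed (t v) (l v) (k v) (d v)).
Proof.
move=> Ht Hl Hk Hd; apply: pr_call; do 3 (apply: pr_lett; first exact: pr_cstc).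
by apply: pr_call; apply: pr_cstc.
Qed.

Lemma pr_translate pairi op t l k e : primrec n t -> primrec n l -> primrec n k -> primrec n e ->
  primrec n (fun v => translate pairi op (t v) (l v) (k v) (e v)).
Proof.
move=> Ht Hl Hk He.
have Harg i : primrec n (fun v => hdn (iter i tln (e v))).
  by apply: pr_hdn; elim: i => //= i IH; apply: pr_tln.
have Hd i : primrec n (fun v => delayed (t v) (l v) (k v) (hdn (iter i tln (e v)))).
  exact: pr_delayed.
have Hn i := pr_numswap Hk (Hd i).
have Hc q : primrec n (fun=> q) by exact: pr_cst.
have Hh := pr_hdn He.
have Hk1 := pr_succ Hk.
apply: pr_if_eq => //; first exact: pr_numswap.
apply: pr_if_eq => //.
apply: pr_if_eq => //; first exact: pr_var.
apply: pr_if_eq => //; first exact: pr_lett.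
apply: pr_if_eq => //; first by apply: pr_code5 => //; exact: pr_shift.
apply: pr_if_eq => //; first by apply: pr_code5 => //; exact: pr_swap.
apply: pr_if_eq => //.
  apply: pr_if_eq => //; first exact: pr_code3.
  do 4 (apply: pr_lett; first exact: pr_cstc).
  by apply: pr_ind; apply: pr_lett => //; apply: pr_lett => //; apply: pr_var; do 5 apply: pr_succ.
apply: pr_call; apply: pr_lett; first exact: pr_var.
do 2 (apply: pr_lett; first exact: pr_cstc).
by apply: pr_call; apply: pr_cstc.
Qed.

End PrimrecCodes.

Opaque cst lett succ_ numswap funswap var appf ind call.

Lemma K_delayed t l k d T F f a c :
  (forall F f r, K t F f (l :: k :: d :: r) T) ->
  K T F f a c -> K (delayed t l k d) F f a c.
Proof.
move=> tP; apply: K_call; do 3 (apply: K_let; first by krun).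
by apply: K_call; [krun | apply: tP].
Qed.

(** * Correctness of the translation *)

Section Translation.
Variables (pairi op t : nat).
Let T l k e := translate pairi op t l k e.
Hypothesis pairiP : forall F f x y r, K pairi F f (x :: y :: r) (pairn x y).
Hypothesis opP : forall F f a d T (stg : Cantor_space -> Prop) next,
  (forall l k F f r, K t F f (l :: k :: d :: r) (T l k)) ->
  (forall X, incl X (next X)) ->
  (forall X, stg X -> stg (next X)) ->
  (forall P : Cantor_space -> Prop, (forall X, P X -> stg X) -> stg (union P)) ->
  (forall X y, stg X -> exists2 c, next X y = X y || (0 < c) &
     forall gs xs, K (T (size gs) (size xs)) F (gs ++ prepend y X :: f) (xs ++ a) c) ->
  forall h js ys,
  K op F (h :: js ++ f) ([:: t, d, size ys, size js & ys ++ a])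
    (`[< legit next h 0 >] && extend next h (h 0)).
Hypothesis tP : forall l k e F f r, K t F f (l :: k :: e :: r) (T l k e).

Let delayedP l k d F f a c :
  K (T l k d) F f a c -> K (delayed t l k d) F f a c.
Proof. by apply: K_delayed => *; apply: tP. Qed.

Lemma K_swap_args e F f xs x a c :
  (forall xs', size xs' = size xs -> K e F f (xs' ++ x :: a) c) ->
  K (numswap (size xs) e) F f (x :: xs ++ a) c.
Proof.
move=> H; apply: K_numswap; first by rewrite /= size_cat ltnS leq_addr.
by have [xs' sx ->] := permuted_swap_mid 0 xs x a; apply: H.
Qed.

Lemma K_swap_head e F f xs x a c : (forall r, K e F f (x :: r) c) ->
  K (numswap (size xs) e) F f (xs ++ x :: a) c.
Proof.
move=> H; apply: K_numswap; first by rewrite size_cat /= addnS ltnS leq_addr.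
by have [r ->] := permuted_swap_head 0 (drop_size_cat (x :: a) (erefl (size xs))).
Qed.

(** The well-order of the partial induction is reused: along it the coded histories are the stages
    of the total operator. *)
Let translate_S8_3 d F f x a (g : Cantor_space) gs xs :
  nonmonotone_induction (operator_of (fun h c => Kleene false d F (h :: f) a c /\
    forall gs xs, K (T (size gs) (size xs) d) F (gs ++ h :: f) (xs ++ a) c)) g ->
  K (lett (cst (size gs)) (lett (cst (size xs).+1) (lett (cst d) (lett (cst t)
      (ind op (lett (cst 0) (lett (var (5 + size xs)) pairi))))))) F (gs ++ f)
    (xs ++ x :: a) (g x).
Proof.
set R := operator_of _ => -[W [lt [s [top [top1 [wo st tn e1 e2]]]]]].
have R_unique X u u' : R X u -> R X u' -> u = u'.
  move=> Ru Ru'; apply/funext => n.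
  have [z [Kz _] ez] := Ru n; have [z' [Kz' _] ez'] := Ru' n.
  move: ez ez'; rewrite (Kleene_unique Kz Kz') => <-; by case: (u n) (u' n) => -[].
(* Where the source operator is undefined, [next X] is [X]; that value is never computed. *)
have /choice[next nextP] : forall X, exists Y, incl X Y /\
    forall u, R X u -> Y = (fun n => X n || u n).
  move=> X; have [[u Ru]|no] := pselect (exists u, R X u); last first.
    by exists X; split=> // u Ru; case: no; exists u.
  exists (fun n => X n || u n); split=> [n ->//|u' Ru'].
  by rewrite (R_unique _ _ _ Ru Ru').
have tf : s top = s top1 by apply/funext.
have Kop h := @opP F f a d (fun l k => T l k d) (stage lt s top) next
  (fun l k F f r => tP l k d F f r) (fun X => proj1 (nextP X)) _
  (stage_union wo st (top := top)) _ h gs (rcons xs x).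
do 4 (apply: K_let; first by krun).
apply: (@K_let _ _ _ _ _ (pairn x 0)).
  apply: K_let; first by krun.
  apply: K_let; last exact: pairiP.
  by apply: (@K_var _ _ _ _ _ a); rewrite /= drop_size_cat.
rewrite e2 -(coded_stage0 s top x).
pose phi h := nat_of_bool (`[< legit next h 0 >] && extend next h (h 0)).
have Kphi h : K op F (h :: gs ++ f) ([:: t, d, (size xs).+1, size gs & xs ++ x :: a]) (phi h).
  rewrite -cat_rcons -(size_rcons xs x); apply: Kop => [X|X y] sX.
    have [u Ru] := stage_next wo st tn tf sX.
    by rewrite (proj2 (nextP X) _ Ru).
  have [u Ru _] := stage_next wo st tn tf sX.
  have [c [_ Kc] ec] := Ru y; exists c => //.
  by rewrite (proj2 (nextP X) _ Ru); move: ec; case: (u y); case: c {Kc}.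
apply: S8_3 => [_ h|]; first by exists (phi h).
exists W, lt, (coded_stage s), top, top1; split=> //.
  have [zr nx lm] := coded_stages wo st (fun X u => proj2 (nextP X) u).
  split=> // w v /nx[u Ru eu]; exists u => // n.
  by have [c -> ec] := Ru n; eexists; [exact: Kphi | exact: ec].
(* A coded stage depends on its index only through the original stage, so the history also stops at
   [top]. *)
by move=> M; rewrite /coded_stage tf.
Qed.

(** The extras are quantified inside the induction because subcomputations run with more of them. *)
Lemma translateP e F f a c : Kleene false e F f a c ->
  forall gs xs, K (T (size gs) (size xs) e) F (gs ++ f) (xs ++ a) c.
Proof.
elim/Kleene_nested_ind => {e F f a c}.
- move=> F f a1 a gs xs; rewrite /T /translate hdn_code.
  by apply: K_swap_head => r; apply: S1.
- by move=> q F f a gs xs; rewrite /T /translate hdn_code; apply: S2.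
- move=> F f a1 a gs xs; rewrite /T /translate hdn_code.
  by apply: K_var; rewrite drop_size_cat.
- move=> e1 e2 F f a b c IH2 IH1 gs xs; rewrite /T /translate hdn_code /= !tln_code !hdn_code.
  apply: K_let; first exact: delayedP (IH2 gs xs).
  apply: K_swap_args => xs' sx; apply: delayedP; rewrite -sx; exact: IH1.
- move=> e1 t1 t2 t3 F f a c p1 p2 p3 IH gs xs.
  rewrite /T /translate hdn_code /= !tln_code !hdn_code /=.
  apply: S6; rewrite ?size_cat ?permuted_shift //; try exact: permutes_shift.
  exact: delayedP.
- move=> F f1 f a1 a gs xs; rewrite /T /translate hdn_code /=.
  apply: (S6 (t1 := [::])); rewrite ?size_cat; first exact: permutes_nil.
  + by apply: permutes_swap; rewrite addnS ltnS leq_addr.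
  + by apply: permutes_swap; rewrite addnS ltnS leq_addr.
  have [fs ->] := permuted_swap_head (fun=> 0) (drop_size_cat (f1 :: f) (erefl (size gs))).
  have [r ->] := permuted_swap_head 0 (drop_size_cat (a1 :: a) (erefl (size xs))).
  exact: S7.
- move=> d F1 F f a g IH gs xs; rewrite /T /translate hdn_code /= !tln_code !hdn_code /=.
  apply: S8_2 => x; apply: K_swap_args => xs' sx; apply: delayedP; rewrite -sx.
  exact: IH.
- move=> d F f x a g nm gs xs; rewrite /T /translate hdn_code /= !tln_code !hdn_code /=.
  exact: translate_S8_3.
- move=> d F f a c IH gs xs; rewrite /T /translate hdn_code.
  apply: K_call.
    apply: K_let; first by apply: (@K_var _ _ _ _ _ a); rewrite drop_size_cat.
    do 2 (apply: K_let; first by krun).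
    by apply: K_call; [krun | apply: tP].
  by rewrite -cat_rcons -(size_rcons xs d); apply: IH.
Qed.

End Translation.

Lemma K_index1 phi : primrec 1 (fun v => phi (nth 0 v 0)) ->
  exists j, forall F f x r, K j F f (x :: r) (phi x).
Proof. by case/primrec_K => j Hj; exists j => F f x r; apply: (Hj F f [:: x] r). Qed.

Lemma K_index2 phi : primrec 2 (fun v => phi (nth 0 v 0) (nth 0 v 1)) ->
  exists j, forall F f x y r, K j F f (x :: y :: r) (phi x y).
Proof. by case/primrec_K => j Hj; exists j => F f x y r; apply: (Hj F f [:: x; y] r). Qed.

Theorem theorem2p11 :
  exists2 rho : nat -> nat, computable rho &
    forall (e : nat) (F : seq ((nat -> nat) -> nat)) (f : seq (nat -> nat))
           (a : seq nat) (b : nat),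
      Kleene_p e F f a b -> Kleene_t (rho e) F f a b.
Proof.
have p0 n : primrec n.+1 (fun v => nth 0 v 0) by exact: pr_nth.
have p1 n : primrec n.+2 (fun v => nth 0 v 1) by exact: pr_nth.
have [pairi pairiP] := K_index2 (pr_pairn (p0 1) (p1 0)).
have [fsti fstiP] := K_index1 (pr_fstn (p0 0)).
have [sndi sndiP] := K_index1 (pr_sndn (p0 0)).
have [predi prediP] := K_index1 (pr_pred (p0 0)).
have [swapi swapiP] := K_index2 (pr_funswap (p0 1) (p1 0)).
have neq_pr : primrec 2 (fun v => nat_of_bool (nth 0 v 0 != nth 0 v 1)).
  apply: (pr_ext (pr_if_eq (p0 1) (p1 0) (pr_cst _ 0) (pr_cst _ 1))) => v _.
  by case: eqP.
have [neqi neqiP] := K_index2 (phi := fun x y => nat_of_bool (x != y)) neq_pr.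
pose op := stage_op pairi fsti sndi neqi swapi predi.
(* Self-application replaces the recursion theorem: [q] receives itself as first argument and
   rebuilds from it [lett (cst q) q], the index of the translator. *)
have [q qP] := primrec_K (pr_translate pairi op
  (pr_lett (pr_cstc (p0 3)) (p0 3)) (p1 2) (pr_nth (n := 4) (i := 2) isT) (pr_nth (n := 4) (i := 3) isT)).
pose tau := lett (cst q) q.
have tauP l k e F f r : K tau F f (l :: k :: e :: r) (translate pairi op tau l k e).
  apply: K_let (K_cst _ _ _ _) _.
  exact: (qP F f [:: q; l; k; e] r).
(* At the outermost level there are no extra arguments. *)
exists (delayed tau 0 0).
  have [p Hp] := primrec_rec (pr_delayed (pr_cst 1 tau) (pr_cst 1 0) (pr_cst 1 0) (p0 0)).
  by exists p => x; apply: (Hp [:: x]).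
move=> e F f a b H; apply: K_delayed => [*|]; first exact: tauP.
apply: (translateP pairiP _ tauP H [::] [::]).
move=> F' f' a' d T stg next tP ni sn su Ts h js ys.
exact: (K_stage_op pairiP fstiP sndiP neqiP swapiP prediP tP ni sn su Ts).
Qed.
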